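(* Let $c>0$, let $\nu,\tilde\nu$ be probability measures on $\mathbb R_+$ different from $\boldsymbol d_0$, and let $m,\mu$ be as below. For $x\neq 0$ let $f(x)=\pi^{-1}\Im m(x)$, where $m(x)=\lim_{z\in\mathbb C_+\to x}m(z)$ (this limit exists and $f$ is the density of $\mu$ on $\mathbb R\setminus\{0\}$). Then $f$ is real analytic in a neighborhood of every $x\neq 0$ for which $f(x)>0$.
   Context: $\mathbb C_+=\{z:\Im z>0\}$, $\boldsymbol d_0$ is the Dirac mass at $0$. For $z\in\mathbb C_+$, $(\delta(z),\tilde\delta(z))$ is the unique solution in $\mathbb C_+^2$ of $\delta = c\int \frac{t}{-z(1+\tilde\delta t)}\nu(dt)$, $\tilde\delta=\int\frac{t}{-z(1+\delta t)}\tilde\nu(dt)$; $m(z)=\int\frac{1}{-z(1+\tilde\delta(z)t)}\nu(dt)$ is the Stieltjes transform $\int\frac{\mu(dt)}{t-z}$ of a probability measure $\mu$ on $\mathbb R_+$. *)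

(* Defs.v *)
From HB Require Import structures.
From mathcomp Require Import all_boot all_order all_algebra.
From mathcomp Require Import all_classical all_reals all_analysis.
From mathcomp Require Import complex.
Set Implicit Arguments. Unset Strict Implicit. Unset Printing Implicit Defensive.
Import Order.TTheory GRing.Theory Num.Theory.
Import numFieldNormedType.Exports.
Local Open Scope classical_set_scope.
Local Open Scope ring_scope.
Local Open Scope complex_scope.

Definition Cplus (R : realType) : set R[i] := [set z | 0 < complex.Im z].

Definition cintegral (R : realType) (mu : {measure set R -> \bar R})
  (g : R -> R[i]) : R[i] :=
  (Rintegral mu setT (fun t => complex.Re (g t))) +i*
  (Rintegral mu setT (fun t => complex.Im (g t))).

Definition real_analytic_at (R : realType) (f : R -> R) (x : R) : Prop :=
  exists2 r : R, 0 < r &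
  exists a : nat -> R, forall y : R, `|y - x| < r ->
    (fun n : nat => \sum_(k < n) a k * (y - x) ^+ k) @ \oo --> f y.

(* Topology (metric from the complex modulus) on R[i], copied from the
   generic numClosedFieldType instance on R[i]^o. *)
HB.instance Definition _ (R : rcfType) :=
  PseudoPointedMetric.copy R[i] (R[i])^o.

(* Main.v *)
(** For [z] in the upper half plane write [a = delta z], [b = deltat z] and
    [H_P(b) = \int t/(1+bt) P(dt)], so that [z b = - H_nut(a)] and
    [z a = - c H_nu(b)]; then [z m(z) = -1 - z a b / c]. Taking imaginary parts
    gives [c G_nu(b) G_nut(a) <= |z|^2], where [G_P(b) = \int |t/(1+bt)|^2 P(dt)].

    If [Im m(x) > 0], this L^2 bound keeps [a] and [b] bounded and bounded away
    from [0] as [z -> x], because [z a b] has a nonreal limit, whereas [a -> 0]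
    or [b -> 0] would force a real one. Hence some limit point [(E, D)] lies in
    the open upper half plane and solves the system at [z = x], with
    [c G_nu(D) G_nut(E) = x^2]. The Jacobian of the system at that point could
    vanish only in the equality case of the triangle inequality for both
    integrals, which makes [D E] real.

    The implicit function theorem is proved by Picard iteration on polynomials:
    the iterates are bounded in a weighted l^1 norm and converge X-adically, so
    their limits are analytic near [x]. By uniqueness these limits are [deltat]
    and [delta] in the upper half plane, and [m = -1/z - a b / c] extends
    analytically across [x]. *)

Require Import Defs.
From HB Require Import structures.
From mathcomp Require Import all_boot all_order all_algebra.
From mathcomp Require Import all_classical all_reals all_analysis.
From mathcomp Require Import complex.
From mathcomp Require Import measurable_realfun.
From mathcomp Require Import ring lra.
Import Order.TTheory GRing.Theory Num.Theory.
Import numFieldNormedType.Exports.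
Import Normc.
Local Open Scope classical_set_scope.
Local Open Scope ring_scope.
Local Open Scope complex_scope.

Set Implicit Arguments. Unset Strict Implicit.

(** * Complex modulus and convergence *)

Arguments normc : simpl never.

Section Modulus.
Context {R : realType}.
Implicit Types (x y z w : R[i]) (a b : R).

(** The measures may have infinite first moment, so [H_P(b)] may blow up as [b -> 0], and the sup
    bound [1 / Im b] of the kernel degenerates at the real axis. Hence the a priori estimates rest
    on energies alone. The product bound comes from using the two equations differently: one gives
    Im (z b) = Im a * G_nut(a) exactly, the other, divided by z, gives Im a >= c Im (z b) G_nu(b) /
    |z|^2, and Im a cancels. At a real point both equations are exact, so the bound becomes an
    equality; this is what turns a vanishing Jacobian into an equality case. Since z a b = - a
    H_nut(a) = - c b H_nu(b), a small [a] or [b] would make this product small; keeping one unknown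
    away from [0] then bounds the other, because the product is bounded. On the real axis 1/z is
    real, so Im m only sees Im (a b): it suffices to expand the product of the two solutions. *)

Lemma normc_ge0 z : 0 <= normc z.
Proof. by case: z => a b; rewrite /normc sqrtr_ge0. Qed.

Lemma normcD x y : normc (x + y) <= normc x + normc y.
Proof. exact: (@le_normcD R). Qed.

Lemma normc_opp x : normc (- x) = normc x.
Proof. exact: (@normcN R). Qed.

Lemma normcB x y : normc (x - y) <= normc x + normc y.
Proof. by rewrite -(normc_opp y); exact: normcD. Qed.

Lemma normcBC x y : normc (x - y) = normc (y - x).
Proof. by rewrite -normc_opp opprB. Qed.

Lemma normc_eq0 z : (normc z == 0) = (z == 0).
Proof. by apply/eqP/eqP => [/eq0_normc//|->]; rewrite normc0. Qed.

Lemma normc_gt0 z : (0 < normc z) = (z != 0).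
Proof. by rewrite lt_neqAle normc_ge0 andbT eq_sym normc_eq0. Qed.

Lemma normcX z n : normc (z ^+ n) = normc z ^+ n.
Proof.
by elim: n => [|n IH]; rewrite ?expr0 ?normc1// !exprS normcM IH.
Qed.

Lemma normc_sum (I : Type) (r : seq I) (P : pred I) (F : I -> R[i]) :
  normc (\sum_(i <- r | P i) F i) <= \sum_(i <- r | P i) normc (F i).
Proof.
elim/big_rec2: _ => [|i y1 y2 _ h]; first by rewrite normc0.
by apply: le_trans (normcD _ _) _; rewrite lerD2l.
Qed.

Lemma normcr a : normc a%:C = `|a|.
Proof. by rewrite /normc /= expr0n /= addr0 sqrtr_sqr. Qed.

Lemma normc_Complex a b : normc (a +i* b) ^+ 2 = a ^+ 2 + b ^+ 2.
Proof. by rewrite /normc sqr_sqrtr // addr_ge0 ?sqr_ge0. Qed.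

Lemma sqr_normcE z : normc z ^+ 2 = complex.Re z ^+ 2 + complex.Im z ^+ 2.
Proof. by case: z => a b; rewrite normc_Complex. Qed.

Lemma le_normc_Re z : `|complex.Re z| <= normc z.
Proof.
by rewrite -(@ler_pXn2r _ 2) ?nnegrE ?normc_ge0 // real_normK ?num_real //
  sqr_normcE lerDl sqr_ge0.
Qed.

Lemma le_normc_Im z : `|complex.Im z| <= normc z.
Proof.
by rewrite -(@ler_pXn2r _ 2) ?nnegrE ?normc_ge0 // real_normK ?num_real //
  sqr_normcE lerDr sqr_ge0.
Qed.

Lemma normc_le_ReIm z : normc z <= `|complex.Re z| + `|complex.Im z|.
Proof.
rewrite -(@ler_pXn2r _ 2) ?nnegrE ?normc_ge0 ?addr_ge0 //.
rewrite sqr_normcE sqrrD !real_normK ?num_real // addrAC lerDl.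
by rewrite mulrn_wge0 // mulr_ge0.
Qed.

Lemma ReD x y : complex.Re (x + y) = complex.Re x + complex.Re y.
Proof. by case: x y => [? ?] [? ?]. Qed.
Lemma ImD x y : complex.Im (x + y) = complex.Im x + complex.Im y.
Proof. by case: x y => [? ?] [? ?]. Qed.
Lemma ReN x : complex.Re (- x) = - complex.Re x.
Proof. by case: x. Qed.
Lemma ImN x : complex.Im (- x) = - complex.Im x.
Proof. by case: x. Qed.
Lemma ReM x y : complex.Re (x * y) =
  complex.Re x * complex.Re y - complex.Im x * complex.Im y.
Proof. by case: x y => [? ?] [? ?]. Qed.
Lemma ImM x y : complex.Im (x * y) =
  complex.Re x * complex.Im y + complex.Im x * complex.Re y.
Proof. by case: x y => [? ?] [? ?]; rewrite /= [X in _ + X]mulrC. Qed.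
Lemma Re_real a : complex.Re a%:C = a. Proof. by []. Qed.
Lemma Im_real a : complex.Im a%:C = 0. Proof. by []. Qed.
Lemma Im_realM a x : complex.Im (a%:C * x) = a * complex.Im x.
Proof. by rewrite ImM Im_real mul0r addr0. Qed.
Lemma ReV x : complex.Re x^-1 = complex.Re x / normc x ^+ 2.
Proof. by case: x => [? ?]; rewrite normc_Complex. Qed.
Lemma ImV x : complex.Im x^-1 = - complex.Im x / normc x ^+ 2.
Proof. by case: x => [? ?]; rewrite normc_Complex /= mulNr. Qed.
Lemma complex_ext x y :
  complex.Re x = complex.Re y -> complex.Im x = complex.Im y -> x = y.
Proof. by case: x y => [? ?] [? ?] /= -> ->. Qed.

Lemma normc_conjc z : normc (conjc z) = normc z.
Proof. by case: z => a b; rewrite /normc /= sqrrN. Qed.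

Lemma mul_conjc_unit z : normc z = 1 -> conjc z * z = 1.
Proof.
move=> z1; apply: complex_ext; last by case: (z) => x y /=; ring.
have := sqr_normcE z; rewrite z1 expr1n /= => ->.
by case: (z) => x y /=; ring.
Qed.

(** Stated through real moduli: in the topology of [R[i]] the radii of balls are themselves complex,
    while squeeze arguments and rates live in [R]. *)
Definition ccvg (u : nat -> R[i]) (l : R[i]) : Prop :=
  (fun n => normc (u n - l)) @ \oo --> (0 : R).

Lemma ccvg_le (u : nat -> R[i]) l (e : nat -> R) :
  (forall n, normc (u n - l) <= e n) -> e @ \oo --> (0 : R) -> ccvg u l.
Proof.
move=> h he; apply: (squeeze_cvgr _ (@cvg_cst _ _ _ _ _) he).
by apply: nearW => n; rewrite normc_ge0 h.
Qed.

Lemma ccvg_cst l : ccvg (fun=> l) l.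
Proof.
by apply: (@ccvg_le _ _ (fun=> 0)); [move=> n; rewrite subrr normc0|exact: cvg_cst].
Qed.

Lemma ccvgD u v l l' : ccvg u l -> ccvg v l' -> ccvg (fun n => u n + v n) (l + l').
Proof.
move=> hu hv; apply: (@ccvg_le _ _ (fun n => normc (u n - l) + normc (v n - l'))).
  by move=> n; rewrite opprD addrACA; exact: normcD.
by rewrite -[X in _ --> X](addr0 0); apply: cvgD.
Qed.

Lemma ccvgM u v l l' :
  ccvg u l -> ccvg v l' -> ccvg (fun n => u n * v n) (l * l').
Proof.
move=> hu hv; apply: (@ccvg_le _ _ (fun n =>
  normc (u n - l) * normc (v n - l') + normc l * normc (v n - l')
  + normc l' * normc (u n - l))).
  move=> n.
  have -> : u n * v n - l * l' =
    (u n - l) * (v n - l') + l * (v n - l') + l' * (u n - l) by ring.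
  rewrite -!normcM; apply: le_trans (normcD _ _) _.
  by rewrite lerD2r; exact: normcD.
have -> : (0 : R) = 0 * 0 + normc l * 0 + normc l' * 0 by rewrite !mulr0 !addr0.
by apply: cvgD; [apply: cvgD|]; apply: cvgM => //; exact: cvg_cst.
Qed.

Lemma ccvg_Re u l : ccvg u l -> (fun n => complex.Re (u n)) @ \oo --> complex.Re l.
Proof.
move=> hu; apply/subr_cvg0/norm_cvg0P.
apply: (squeeze_cvgr _ (@cvg_cst _ _ _ _ _) hu).
by apply: nearW => n; rewrite normr_ge0 /= -ReN -ReD le_normc_Re.
Qed.

Lemma ccvg_Im u l : ccvg u l -> (fun n => complex.Im (u n)) @ \oo --> complex.Im l.
Proof.
move=> hu; apply/subr_cvg0/norm_cvg0P.
apply: (squeeze_cvgr _ (@cvg_cst _ _ _ _ _) hu).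
by apply: nearW => n; rewrite normr_ge0 /= -ImN -ImD le_normc_Im.
Qed.

Lemma ccvg_ReIm u l :
  (fun n => complex.Re (u n)) @ \oo --> complex.Re l ->
  (fun n => complex.Im (u n)) @ \oo --> complex.Im l -> ccvg u l.
Proof.
move=> /subr_cvg0 /(iffRL (norm_cvg0P _)) hr /subr_cvg0 /(iffRL (norm_cvg0P _)) hi.
apply: (ccvg_le (e := fun n => `|complex.Re (u n) - complex.Re l| +
   `|complex.Im (u n) - complex.Im l|)).
  by move=> n; rewrite -ReN -ReD -ImN -ImD normc_le_ReIm.
by rewrite -[X in _ --> X](addr0 0); apply: cvgD.
Qed.

Lemma ccvg_unique u l l' : ccvg u l -> ccvg u l' -> l = l'.
Proof.
move=> hu hv; apply: complex_ext.
  exact: (cvg_unique _ (ccvg_Re hu) (ccvg_Re hv)).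
exact: (cvg_unique _ (ccvg_Im hu) (ccvg_Im hv)).
Qed.

Lemma geometric_ccvg (u : nat -> R[i]) (B t : R) : 0 <= B -> 0 <= t < 1 ->
  (forall n, normc (u n.+1 - u n) <= B * t ^+ n) ->
  exists l, forall n, normc (u n - l) <= B / (1 - t) * t ^+ n.
Proof.
move=> B0 /andP[t0 t1] hu.
have geo : cvgn (series (geometric B t)).
  by apply: is_cvg_geometric_series; rewrite ger0_norm.
have real_cvg (v : nat -> R) : (forall n, `|v n.+1 - v n| <= B * t ^+ n) -> cvgn v.
  move=> hv.
  have vE : v = [sequence v 0%N]_n + series (telescope v).
    by apply/funext => n; rewrite [LHS]eq_sum_telescope.
  rewrite vE; apply: is_cvgD; first exact: is_cvg_cst.
  apply: normed_cvg; apply: (series_le_cvg _ _ _ geo) => n //=.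
    by rewrite /geometric /= mulr_ge0 ?exprn_ge0.
  exact: hv.
have /cvg_ex[lr hr] : cvgn (fun n => complex.Re (u n)).
  apply: real_cvg => n; apply: le_trans (hu n).
  by rewrite -ReN -ReD; exact: le_normc_Re.
have /cvg_ex[li hi] : cvgn (fun n => complex.Im (u n)).
  apply: real_cvg => n; apply: le_trans (hu n).
  by rewrite -ImN -ImD; exact: le_normc_Im.
pose l := lr +i* li; exists l => n.
have hl : ccvg u l by exact: ccvg_ReIm.
(* The geometric sum in closed form, so that the induction on [m] closes; dropping [t ^+ (n + m)]
   leaves the tail estimate. *)
have hm m : normc (u (n + m)%N - u n) <= B / (1 - t) * (t ^+ n - t ^+ (n + m)).
  elim: m => [|m IH]; first by rewrite addn0 !subrr normc0 mulr0.
  rewrite addnS; have -> : u (n + m).+1 - u n =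
    (u (n + m).+1 - u (n + m)%N) + (u (n + m)%N - u n) by ring.
  apply: le_trans (normcD _ _) _; apply: le_trans (lerD (hu _) IH) _.
  rewrite exprS le_eqVlt; apply/orP; left; apply/eqP; field.
  by rewrite subr_eq0 eq_sym lt_eqF.
apply/ler_addgt0Pr => e e0.
have [N _ hN] := (cvgr0_norm_lt _ hl) _ e0.
have := hN (n + N)%N (leq_addl _ _); rewrite /= ger0_norm ?normc_ge0 // => h.
have -> : u n - l = - (u (n + N)%N - u n) + (u (n + N)%N - l) by ring.
apply: le_trans (normcD _ _) _; rewrite normc_opp lerD ?(ltW h) //.
apply: le_trans (hm _) _; rewrite ler_wpM2l ?lerBlDr ?lerDl ?exprn_ge0 //.
by rewrite divr_ge0 // subr_ge0 ltW.
Qed.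

Lemma ccvg_geometric (u : nat -> R[i]) l (B t : R) : 0 <= t < 1 ->
  (forall n, normc (u n - l) <= B * t ^+ n) -> ccvg u l.
Proof.
move=> /andP[t0 t1] hu; apply: (@ccvg_le _ _ (fun n => B * t ^+ n)) => //.
by apply: cvg_geometric; rewrite ger0_norm.
Qed.

End Modulus.

(** * Weighted l^1 norm on polynomials *)

Section PolyNorm.
Context {R : realType}.
Implicit Types (p q : {poly R[i]}) (r t : R) (z : R[i]).

(** A majorant norm for the disc of radius [r]: it is submultiplicative and dominates every value
    there, so iterates are bounded by algebra on coefficients. *)
Definition pnorm r p : R := \sum_(i < size p) normc p`_i * r ^+ i.

Lemma pnorm_widen r n p : (size p <= n)%N ->
  pnorm r p = \sum_(i < n) normc p`_i * r ^+ i.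
Proof.
move=> pn; rewrite /pnorm (big_ord_widen n (fun i => normc p`_i * r ^+ i)) //.
rewrite big_mkcond; apply: eq_bigr => i _; case: ltnP => // h.
by rewrite nth_default // normc0 mul0r.
Qed.

Lemma pnorm_ge0 r p : 0 <= r -> 0 <= pnorm r p.
Proof. by move=> r0; apply: sumr_ge0 => i _; rewrite mulr_ge0 ?normc_ge0 ?exprn_ge0. Qed.

Lemma pnorm0 r : pnorm r 0 = 0.
Proof. by rewrite /pnorm size_poly0 big_ord0. Qed.

Lemma pnormC r c : pnorm r c%:P = normc c.
Proof.
by rewrite (@pnorm_widen _ 1) ?size_polyC_leq1 // big_ord1 coefC expr0 mulr1.
Qed.

Lemma pnormX r : pnorm r 'X = r.
Proof.
by rewrite /pnorm size_polyX !big_ord_recl big_ord0 !coefX /= normc0 normc1;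
  ring.
Qed.

Lemma pnormD r p q : 0 <= r -> pnorm r (p + q) <= pnorm r p + pnorm r q.
Proof.
move=> r0; pose n := maxn (size p) (size q).
rewrite !(@pnorm_widen _ n) ?leq_maxl ?leq_maxr ?size_polyD // -big_split /=.
apply: ler_sum => i _; rewrite coefD -mulrDl ler_wpM2r ?exprn_ge0 //.
exact: normcD.
Qed.

Lemma pnormZ r c p : pnorm r (c *: p) = normc c * pnorm r p.
Proof.
rewrite (@pnorm_widen _ (size p)) ?size_scale_leq // mulr_sumr.
by apply: eq_bigr => i _; rewrite coefZ normcM mulrA.
Qed.

Lemma pnormN r p : pnorm r (- p) = pnorm r p.
Proof. by rewrite -scaleN1r pnormZ normc_opp normc1 mul1r. Qed.

Lemma pnormMX r p : pnorm r (p * 'X) = pnorm r p * r.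
Proof.
rewrite (@pnorm_widen _ (size p).+1).
  rewrite big_ord_recl coefMX normc0 mul0r add0r mulr_suml.
  by apply: eq_bigr => i _; rewrite coefMX /= exprSr mulrA.
by have [->|/size_mulX->] := eqVneq p 0; rewrite ?mul0r ?size_poly0.
Qed.

Lemma pnorm_cons r p c : pnorm r (p * 'X + c%:P) = pnorm r p * r + normc c.
Proof.
rewrite (@pnorm_widen _ (size p).+1); last first.
  apply: leq_trans (size_polyD _ _) _; rewrite geq_max.
  rewrite (leq_trans (size_polyC_leq1 _)) // andbT.
  by have [->|/size_mulX->] := eqVneq p 0; rewrite ?mul0r ?size_poly0.
rewrite big_ord_recl coefD coefMX coefC /= add0r expr0 mulr1 addrC mulr_suml.
congr (_ + _); apply: eq_bigr => i _.
by rewrite coefD coefMX coefC /= addr0 exprSr mulrA.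
Qed.

Lemma pnormM r p q : 0 <= r -> pnorm r (p * q) <= pnorm r p * pnorm r q.
Proof.
move=> r0; elim/poly_ind: p => [|p c IH]; first by rewrite mul0r pnorm0 mul0r.
rewrite pnorm_cons mulrDl mulrAC mul_polyC; apply: le_trans (pnormD _ _ r0) _.
by rewrite pnormMX pnormZ mulrDl lerD2r mulrAC ler_wpM2r.
Qed.

Lemma pnormXn r p n : 0 <= r -> pnorm r (p ^+ n) <= pnorm r p ^+ n.
Proof.
move=> r0; elim: n => [|n IH]; first by rewrite !expr0 pnormC normc1.
rewrite !exprS; apply: le_trans (pnormM _ _ r0) _.
by rewrite ler_wpM2l ?pnorm_ge0.
Qed.

Lemma pnorm_sum r (I : Type) (s : seq I) (F : I -> {poly R[i]}) : 0 <= r ->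
  pnorm r (\sum_(i <- s) F i) <= \sum_(i <- s) pnorm r (F i).
Proof.
move=> r0; elim/big_rec2: _ => [|i y1 y2 _ h]; first by rewrite pnorm0.
by apply: le_trans (pnormD _ _ r0) _; rewrite lerD2l.
Qed.

(** On the smaller disc each monomial of degree [i >= n] gains a factor [t ^+ i <= t ^+ n]; this
    turns X-adic closeness into geometric convergence. *)
Lemma horner_pnorm r p z t n : 0 <= r -> 0 <= t <= 1 -> normc z <= t * r ->
  (forall i, (i < n)%N -> p`_i = 0) -> normc p.[z] <= pnorm r p * t ^+ n.
Proof.
move=> r0 /andP[t0 t1] hz hp; rewrite horner_coef mulr_suml.
apply: le_trans (normc_sum _ _ _) _; apply: ler_sum => i _.
have [/hp->|hi] := ltnP i n; first by rewrite mul0r normc0 !mul0r.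
rewrite normcM normcX -mulrA ler_wpM2l ?normc_ge0 //.
apply: (@le_trans _ _ ((t * r) ^+ i)).
  by rewrite lerXn2r ?nnegrE ?normc_ge0 ?mulr_ge0.
rewrite exprMn mulrC ler_wpM2l ?exprn_ge0 //.
exact: ler_wiXn2l.
Qed.

Lemma dvdXn_coef p n i : 'X^n %| p -> (i < n)%N -> p`_i = 0.
Proof. by move=> /dvdpP[q ->] h; rewrite coefMXn h. Qed.

(** The quotient of [p - p.[z]] by ['X - z] supplies the constant, which may depend on [z]; only
    continuity at one point is drawn from it. *)
Lemma horner_lipschitz r p z : 0 <= r -> normc z <= r -> exists2 L, 0 <= L &
  forall w, normc w <= r -> normc (p.[w] - p.[z]) <= L * normc (w - z).
Proof.
move=> r0 hz; have : root (p - (p.[z])%:P) z by rewrite /root !hornerE subrr.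
move=> /factor_theorem[q hq]; exists (pnorm r q); first exact: pnorm_ge0.
move=> w hw; have -> : p.[w] - p.[z] = (p - (p.[z])%:P).[w] by rewrite !hornerE.
rewrite hq hornerM normcM hornerXsubC ler_wpM2r ?normc_ge0 //.
have := @horner_pnorm r q w 1 0 r0; rewrite expr0 mulr1 mul1r; apply => //.
by rewrite ler01 lexx.
Qed.

(** X-adic agreement fixes each coefficient after finitely many steps, and the norm bound makes
    consecutive differences at most [2 * M * t ^+ n] on the disc of radius [t * r]. The limit is
    therefore a power series, with a uniform rate on smaller discs. *)
Lemma poly_seq_limit (P : nat -> {poly R[i]}) (r M : R) : 0 < r -> 0 <= M ->
  (forall j, pnorm r (P j) <= M) -> (forall j, 'X^j %| P j.+1 - P j) ->
  exists W : R[i] -> R[i],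
    (forall z t n, 0 <= t < 1 -> normc z <= t * r ->
       normc ((P n).[z] - W z) <= 2 * M / (1 - t) * t ^+ n) /\
    (exists w : nat -> R[i], forall z, normc z < r ->
       ccvg (fun n => \sum_(k < n) w k * z ^+ k) (W z)).
Proof.
move=> r0 M0 PM PX.
have stable i j k : (i < j)%N -> (P (j + k)%N)`_i = (P j)`_i.
  move=> ij; elim: k => [|k IH]; first by rewrite addn0.
  rewrite addnS -IH; apply/eqP; rewrite -subr_eq0 -coefB; apply/eqP.
  by apply: dvdXn_coef (PX _) _; rewrite ltn_addr.
have lim z : exists l, normc z < r -> forall t n, 0 <= t < 1 -> normc z <= t * r ->
    normc ((P n).[z] - l) <= 2 * M / (1 - t) * t ^+ n.
  have [zr|_] := ltP (normc z) r; last by exists 0.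
  have hB t : 0 <= t < 1 -> normc z <= t * r -> exists l,
      forall n, normc ((P n).[z] - l) <= 2 * M / (1 - t) * t ^+ n.
    move=> t01 hz; apply: geometric_ccvg => //; first by rewrite mulr_ge0.
    move=> n; case/andP: (t01) => t0 t1; rewrite -hornerN -hornerD.
    have t01' : 0 <= t <= 1 by rewrite t0 ltW.
    apply: le_trans (horner_pnorm (ltW r0) t01' hz (n := n) _) _.
      by move=> i; exact: dvdXn_coef (PX _).
    rewrite ler_wpM2r ?exprn_ge0 //; apply: le_trans (pnormD _ _ (ltW r0)) _.
    by rewrite pnormN mulr_natl mulr2n lerD.
  (* [t0] is the least ratio admissible for [z]; uniqueness of limits makes its limit serve every
     other [t]. *)
  pose t0 := normc z / r.
  have t001 : 0 <= t0 < 1.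
    by rewrite divr_ge0 ?normc_ge0 ?(ltW r0) //= ltr_pdivrMr // mul1r.
  have [|l hl] := hB t0 t001; first by rewrite /t0 divfK ?gt_eqF.
  exists l => _ t n t01 hz; have [l' hl'] := hB t t01 hz.
  by rewrite (ccvg_unique (ccvg_geometric t001 hl) (ccvg_geometric t01 hl')).
have [W hW] := choice lim; exists W; split.
  move=> z t n t01 hz; apply: hW => //; apply: le_lt_trans hz _.
  by case/andP: t01 => _ t1; rewrite gtr_pMl.
(* The coefficient of degree [k] no longer changes from index [k.+1] on. *)
exists (fun k => (P k.+1)`_k) => z zr.
pose t := normc z / r.
have t01 : 0 <= t < 1.
  by rewrite divr_ge0 ?normc_ge0 ?(ltW r0) //= ltr_pdivrMr // mul1r.
have hz : normc z <= t * r by rewrite /t divfK ?gt_eqF.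
apply: (@ccvg_geometric _ _ _ (M + 2 * M / (1 - t)) t) => // n.
(* [Q] is [P n] cut below degree [n]: up to sign, [Q - P n] is a tail of [P n], of norm at most [M]
   and of order at least [n]. *)
pose Q := \poly_(k < n) (P n)`_k.
have -> : \sum_(k < n) (P k.+1)`_k * z ^+ k = Q.[z].
  rewrite horner_poly; apply: eq_bigr => k _; congr (_ * _).
  by have := stable k k.+1 (n - k.+1)%N (ltnSn k); rewrite subnKC.
have -> : Q.[z] - W z = (Q - P n).[z] + ((P n).[z] - W z).
  by rewrite hornerD hornerN; ring.
apply: le_trans (normcD _ _) _; rewrite mulrDl lerD ?hW //.
have t01' : 0 <= t <= 1 by case/andP: t01 => ? /ltW ->; rewrite andbT.
apply: le_trans (horner_pnorm (ltW r0) t01' hz (n := n) _) _.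
  by move=> i ni; rewrite coefB coef_poly ni subrr.
rewrite ler_wpM2r ?exprn_ge0 //; first by case/andP: t01.
apply: le_trans (PM n).
have hs : (size (Q - P n)%R <= maxn n (size (P n)))%N.
  apply: leq_trans (size_polyD _ _) _; rewrite size_polyN geq_max leq_maxr andbT.
  by rewrite (leq_trans (size_poly _ _)) // leq_maxl.
rewrite (pnorm_widen _ hs) (@pnorm_widen _ (maxn n (size (P n)))) ?leq_maxr //.
apply: ler_sum => i _; rewrite ler_wpM2r ?exprn_ge0 ?(ltW r0) //.
by rewrite coefB coef_poly; case: ltnP; rewrite ?subrr ?normc0 ?normc_ge0 ?sub0r ?normc_opp.
Qed.

(** A three-epsilon argument: [s < r] gives the uniform rate [t = s / r]. *)
Lemma poly_limit_continuous (P : nat -> {poly R[i]}) (r B : R) (W : R[i] -> R[i]) :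
  0 < r -> (forall z t n, 0 <= t < 1 -> normc z <= t * r ->
       normc ((P n).[z] - W z) <= B / (1 - t) * t ^+ n) ->
  forall (s : R) (zs : nat -> R[i]) z, s < r -> (forall n, normc (zs n) <= s) ->
    normc z <= s -> ccvg zs z -> ccvg (fun n => W (zs n)) (W z).
Proof.
move=> r0 hW s zs z sr hzs hz cz.
have s0 : 0 <= s by exact: le_trans (normc_ge0 _) hz.
pose t := s / r.
have t01 : 0 <= t < 1 by rewrite divr_ge0 ?(ltW r0) //= ltr_pdivrMr // mul1r.
have ts : s = t * r by rewrite /t divfK ?gt_eqF.
have hg : (fun n => B / (1 - t) * t ^+ n) @ \oo --> (0 : R).
  by apply: cvg_geometric; case/andP: t01 => ? ?; rewrite ger0_norm.
apply/cvgr0Pnorm_le => e e0; have e3 : 0 < e / 3 by rewrite divr_gt0.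
have [N _ hN] := (cvgr0_norm_lt _ hg) _ e3.
have {}hN : B / (1 - t) * t ^+ N <= e / 3.
  by apply: le_trans (ler_norm _) _; apply: ltW; exact: hN (leqnn N).
have [L L0 hL] := horner_lipschitz (P N) s0 hz.
have e3L : 0 < e / 3 / (L + 1) by rewrite divr_gt0 // ltr_wpDl.
have [N' _ hN'] := (cvgr0_norm_lt _ cz) _ e3L.
exists N' => // n nN'; rewrite /= ger0_norm ?normc_ge0 //.
have := hN' n nN'; rewrite /= ger0_norm ?normc_ge0 // => h.
have -> : W (zs n) - W z = - ((P N).[zs n] - W (zs n)) + ((P N).[zs n] - (P N).[z])
  + ((P N).[z] - W z) by ring.
have h1 : normc ((P N).[zs n] - W (zs n)) <= e / 3.
  by apply: le_trans (hW _ t _ t01 _) hN; rewrite -ts.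
have h2 : normc ((P N).[z] - W z) <= e / 3.
  by apply: le_trans (hW _ t _ t01 _) hN; rewrite -ts.
have h3 : normc ((P N).[zs n] - (P N).[z]) <= e / 3.
  apply: le_trans (hL _ (hzs n)) _.
  apply: le_trans (ler_wpM2l L0 (ltW h)) _.
  rewrite mulrA ler_pdivrMr ?ltr_wpDl // mulrC ler_wpM2l ?(ltW e3) //.
  by rewrite lerDl.
apply: le_trans (normcD _ _) _; have := normcD (- ((P N).[zs n] - W (zs n)))
  ((P N).[zs n] - (P N).[z]).
rewrite normc_opp; lra.
Qed.

End PolyNorm.

(** * Analytic implicit function theorem *)

Section AnalyticSystem.
Context {R : realType}.
Implicit Types (p q : {poly R[i]}) (al : nat -> R[i]).

(** Starting at the square leaves only the nonlinear remainder; cutting at [N] keeps the Picard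
    iterates polynomial. *)
Definition trunc_series al N p : {poly R[i]} := \sum_(k < N) al k *: p ^+ k.+2.

Lemma sum_half_le N : \sum_(k < N) 2^-1 ^+ k <= (2 : R).
Proof.
suff -> : \sum_(k < N) 2^-1 ^+ k = 2 - 2 * 2^-1 ^+ N :> R.
  by rewrite gerBl mulr_ge0 // exprn_ge0 // invr_ge0.
elim: N => [|N IH]; first by rewrite big_ord0 expr0 mulr1 subrr.
by rewrite big_ord_recr /= IH exprS; field.
Qed.

(** [K * rho <= 2^-1] makes the sum geometric with ratio one half; the bound is quadratic in [rho],
    hence small against [rho]. *)
Lemma pnorm_trunc_series al N p (r rho M K : R) : 0 <= r -> 0 <= M -> 0 <= K ->
  (forall k, normc (al k) <= M * K ^+ k) -> K * rho <= 2^-1 ->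
  pnorm r p <= rho -> pnorm r (trunc_series al N p) <= 2 * M * rho ^+ 2.
Proof.
move=> r0 M0 K0 hal Kr hp.
have p0 : 0 <= pnorm r p by exact: pnorm_ge0.
have rho0 : 0 <= rho := le_trans p0 hp.
apply: le_trans (pnorm_sum _ _ r0) _.
apply: (@le_trans _ _ (\sum_(k < N) M * rho ^+ 2 * 2^-1 ^+ k)).
  apply: ler_sum => k _; rewrite pnormZ.
  apply: (@le_trans _ _ ((M * K ^+ k) * rho ^+ k.+2)).
    rewrite ler_pM ?normc_ge0 ?pnorm_ge0 //.
    apply: le_trans (pnormXn _ _ r0) _.
    by rewrite lerXn2r ?nnegrE.
  have -> : M * K ^+ k * rho ^+ k.+2 = M * rho ^+ 2 * (K * rho) ^+ k.
    by rewrite -addn2 exprD exprMn; ring.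
  rewrite ler_wpM2l ?mulr_ge0 ?exprn_ge0 //.
  by rewrite lerXn2r ?nnegrE ?mulr_ge0 ?invr_ge0.
rewrite -mulr_sumr (_ : 2 * M * rho ^+ 2 = M * rho ^+ 2 * 2); last by ring.
by rewrite ler_wpM2l ?mulr_ge0 ?exprn_ge0 // sum_half_le.
Qed.

Lemma dvdX_trunc_series al N p : 'X %| p -> 'X %| trunc_series al N p.
Proof.
move=> hp; rewrite /trunc_series; elim/big_rec: _ => [|k y _ hy].
  exact: dvdp0.
by rewrite dvdp_add // -mul_polyC dvdp_mull // exprS dvdp_mulr.
Qed.

Lemma dvdXn_subXX j p q n : 'X^j %| p - q -> 'X^j %| p ^+ n - q ^+ n.
Proof. by move=> h; rewrite subrXX dvdp_mulr. Qed.

(** One order is gained because every power is at least a square and both arguments vanish at [0];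
    the additional last term has order at least [j.+2]. This gain drives the X-adic convergence. *)
Lemma dvdXn_trunc_series al j p q : 'X %| p -> 'X %| q -> 'X^j %| p - q ->
  'X^(j.+1) %| trunc_series al j.+1 p - trunc_series al j q.
Proof.
move=> hp hq hpq; rewrite /trunc_series big_ord_recr /= addrAC -sumrB dvdp_add //.
  elim/big_rec: _ => [|k y _ hy]; first exact: dvdp0.
  rewrite dvdp_add // -scalerBr.
  have -> : p ^+ k.+2 - q ^+ k.+2 =
     p * (p ^+ k.+1 - q ^+ k.+1) + q * (q ^+ k * (p - q)).
    by rewrite !exprS; ring.
  rewrite -mul_polyC dvdp_mull // exprS dvdp_add // dvdp_mul //.
    exact: dvdXn_subXX.
  by rewrite dvdp_mull.
rewrite -mul_polyC dvdp_mull // (exprS p) dvdp_mull //.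
exact: dvdp_exp2r.
Qed.

End AnalyticSystem.

(** * Picard iteration for a system of two analytic equations *)

Section AnalyticSystemSolution.
Context {R : realType}.
Variables (D E s11 s12 s21 s22 : R[i]) (al be : nat -> R[i]) (Fa Fb : R[i] -> R[i]).
Variables (M K B L rho0 : R).
Hypotheses (M0 : 0 < M) (K0 : 0 < K) (rho00 : 0 < rho0).
Hypothesis al_le : forall k, normc (al k) <= M * K ^+ k.
Hypothesis be_le : forall k, normc (be k) <= M * K ^+ k.
Hypothesis Fa_series : forall w n, normc w <= rho0 ->
  normc (\sum_(k < n) al k * w ^+ k.+2 - Fa w) <= B * 2^-1 ^+ n.
Hypothesis Fb_series : forall w n, normc w <= rho0 ->
  normc (\sum_(k < n) be k * w ^+ k.+2 - Fb w) <= B * 2^-1 ^+ n.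
Hypothesis Fa_lip : forall w w', normc w <= rho0 -> normc w' <= rho0 ->
  normc (Fa w - Fa w') <= L * normc (w - w').
Hypothesis Fb_lip : forall w w', normc w <= rho0 -> normc w' <= rho0 ->
  normc (Fb w - Fb w') <= L * normc (w - w').

(** What remains on the right once the linear part has been moved to the left: quadratic remainders,
    and the terms carrying the displacement ['X] of the spectral parameter. The matrix of the [s]
    coefficients is to invert the linear part. Truncating at order [j] in step [j] is harmless
    X-adically. *)
Let R1 N (pq : {poly R[i]} * {poly R[i]}) : {poly R[i]} :=
  trunc_series al N pq.2 - 'X * (D%:P + pq.1).
Let R2 N (pq : {poly R[i]} * {poly R[i]}) : {poly R[i]} :=
  trunc_series be N pq.1 - 'X * (E%:P + pq.2).
Let step N pq := (s11 *: R1 N pq + s12 *: R2 N pq, s21 *: R1 N pq + s22 *: R2 N pq).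
Let iterates := fix it j := if j is j'.+1 then step j' (it j') else (0, 0).

Let iter_dvdX j : 'X %| (iterates j).1 /\ 'X %| (iterates j).2.
Proof.
elim: j => [|j [h1 h2]] /=; first by rewrite !dvdp0.
have hR1 : 'X %| R1 j (iterates j).
  by rewrite dvdp_sub ?dvdX_trunc_series // dvdp_mulr.
have hR2 : 'X %| R2 j (iterates j).
  by rewrite dvdp_sub ?dvdX_trunc_series // dvdp_mulr.
by split; rewrite -!mul_polyC dvdp_add // dvdp_mull.
Qed.

Let iter_dvdXn j : 'X^j %| (iterates j.+1).1 - (iterates j).1 /\
  'X^j %| (iterates j.+1).2 - (iterates j).2.
Proof.
elim: j => [|j [h1 h2]]; first by rewrite expr0 !dvd1p.
have [p1 p2] := iter_dvdX j; have [q1 q2] := iter_dvdX j.+1.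
have hR1 : 'X^(j.+1) %| R1 j.+1 (iterates j.+1) - R1 j (iterates j).
  rewrite /R1; set S' := trunc_series _ _ _; set S := trunc_series _ j _.
  have -> : S' - 'X * (D%:P + (iterates j.+1).1) - (S - 'X * (D%:P + (iterates j).1))
     = (S' - S) - 'X * ((iterates j.+1).1 - (iterates j).1) by ring.
  rewrite dvdp_sub ?dvdXn_trunc_series // exprS dvdp_mul //.
have hR2 : 'X^(j.+1) %| R2 j.+1 (iterates j.+1) - R2 j (iterates j).
  rewrite /R2; set S' := trunc_series _ _ _; set S := trunc_series _ j _.
  have -> : S' - 'X * (E%:P + (iterates j.+1).2) - (S - 'X * (E%:P + (iterates j).2))
     = (S' - S) - 'X * ((iterates j.+1).2 - (iterates j).2) by ring.
  rewrite dvdp_sub ?dvdXn_trunc_series // exprS dvdp_mul //.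
have lin a b (x x' y y' : {poly R[i]}) : 'X^(j.+1) %| x' - x -> 'X^(j.+1) %| y' - y ->
    'X^(j.+1) %| (a *: x' + b *: y') - (a *: x + b *: y).
  move=> hx hy; rewrite opprD addrACA -!scalerBr -!mul_polyC.
  by rewrite dvdp_add // dvdp_mull.
by split; apply: lin.
Qed.

(** The series is given for the product only, which is all that the density sees; continuity of the
    product serves to pass from the upper half plane to real points. *)
Theorem analytic_system_solution : exists2 r : R, 0 < r &
  exists (U V : R[i] -> R[i]) (w : nat -> R[i]),
  (forall z, normc z < r ->
    [/\ normc (U z) <= rho0, normc (V z) <= rho0,
        U z = s11 * (Fa (V z) - z * (D + U z)) + s12 * (Fb (U z) - z * (E + V z)),
        V z = s21 * (Fa (V z) - z * (D + U z)) + s22 * (Fb (U z) - z * (E + V z)) &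
        ccvg (fun n => \sum_(k < n) w k * z ^+ k) ((D + U z) * (E + V z))]) /\
  (forall (s : R) (zs : nat -> R[i]) z, s < r -> (forall n, normc (zs n) <= s) ->
     normc z <= s -> ccvg zs z ->
     ccvg (fun n => (D + U (zs n)) * (E + V (zs n))) ((D + U z) * (E + V z))).
Proof.
pose S : R := normc s11 + normc s12 + normc s21 + normc s22 + 1.
have S0 : 0 < S by rewrite ltr_wpDl // !addr_ge0 ?normc_ge0.
(* Three constraints: the domain of [Fa] and [Fb], ratio at most one half in the series, and
   [8 * S * M * rho <= 1], which keeps the quadratic terms within half of the budget [rho]. *)
pose rho := Num.min rho0 (Num.min (2^-1 / K) (8 * S * M)^-1).
have rhop : 0 < rho.
  by rewrite !lt_min rho00 divr_gt0 ?invr_gt0 //= !mulr_gt0.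
have rho_le0 : rho <= rho0 by rewrite ge_min lexx.
have Krho : K * rho <= 2^-1.
  by rewrite mulrC -ler_pdivlMr // !ge_min lexx orbT.
have rho8 : rho * (8 * S * M) <= 1.
  by rewrite -ler_pdivlMr ?mulr_gt0 // mul1r !ge_min lexx !orbT.
pose T := normc D + normc E + 2 * rho + 1.
have T0 : 0 < T by rewrite ltr_wpDl // !addr_ge0 ?normc_ge0 ?mulr_ge0 ?ltW.
(* The terms carrying ['X] cost at most [S * (r * T) = rho / 2], the other half of the budget. *)
pose r := rho / (2 * S * T).
have rp : 0 < r by rewrite divr_gt0 // !mulr_gt0.
have r0 := ltW rp.
have bound j : pnorm r (iterates j).1 <= rho /\ pnorm r (iterates j).2 <= rho.
  elim: j => [|j [h1 h2]] /=; first by rewrite !pnorm0 ltW.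
  have hX (c : R[i]) p : pnorm r p <= rho ->
      pnorm r (- ('X * (c%:P + p))) <= r * (normc c + rho).
    move=> hp; rewrite pnormN; apply: le_trans (pnormM _ _ r0) _.
    rewrite pnormX ler_wpM2l //; apply: le_trans (pnormD _ _ r0) _.
    by rewrite pnormC lerD2l.
  have hR1 : pnorm r (R1 j (iterates j)) <= 2 * M * rho ^+ 2 + r * (normc D + rho).
    apply: le_trans (pnormD _ _ r0) _; rewrite lerD ?hX //.
    exact: (pnorm_trunc_series _ r0 (ltW M0) (ltW K0)).
  have hR2 : pnorm r (R2 j (iterates j)) <= 2 * M * rho ^+ 2 + r * (normc E + rho).
    apply: le_trans (pnormD _ _ r0) _; rewrite lerD ?hX //.
    exact: (pnorm_trunc_series _ r0 (ltW M0) (ltW K0)).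
  have hsum : pnorm r (R1 j (iterates j)) + pnorm r (R2 j (iterates j)) <= rho / S.
    rewrite ler_pdivlMr //.
    have e1 : r * T * S = rho / 2 by rewrite /r; field; rewrite !gt_eqF.
    have e2 : 4 * M * rho ^+ 2 * S <= rho / 2.
      have -> : 4 * M * rho ^+ 2 * S = rho * (rho * (8 * S * M)) / 2 by field.
      by rewrite ler_pM2r ?invr_gt0 // ler_piMr // ltW.
    apply: le_trans (_ : (4 * M * rho ^+ 2 + r * T) * S <= _).
      rewrite ler_pM2r //; apply: le_trans (lerD hR1 hR2) _.
      by rewrite /T; nra.
    by rewrite mulrDl e1; lra.
  have comb a b (x y : {poly R[i]}) : normc a <= S -> normc b <= S ->
      pnorm r x + pnorm r y <= rho / S -> pnorm r (a *: x + b *: y) <= rho.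
    move=> ha hb hxy; apply: le_trans (pnormD _ _ r0) _; rewrite !pnormZ.
    apply: le_trans (_ : S * (pnorm r x + pnorm r y) <= _).
      by rewrite mulrDr lerD // ler_wpM2r ?pnorm_ge0.
    by rewrite mulrC -ler_pdivlMr.
  have := normc_ge0 s11; have := normc_ge0 s12; have := normc_ge0 s21.
  have := normc_ge0 s22 => ? ? ? ?.
  by split; apply: comb => //; rewrite /S; lra.
have [U [hU _]] := poly_seq_limit rp (ltW rhop) (fun j => (bound j).1)
  (fun j => (iter_dvdXn j).1).
have [V [hV _]] := poly_seq_limit rp (ltW rhop) (fun j => (bound j).2)
  (fun j => (iter_dvdXn j).2).
pose P j := (D%:P + (iterates j).1) * (E%:P + (iterates j).2).
have P_bound j : pnorm r (P j) <= (normc D + rho) * (normc E + rho).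
  have [h1 h2] := bound j.
  apply: le_trans (pnormM _ _ r0) _; apply: ler_pM; rewrite ?pnorm_ge0 //.
    by apply: le_trans (pnormD _ _ r0) _; rewrite pnormC lerD2l.
  by apply: le_trans (pnormD _ _ r0) _; rewrite pnormC lerD2l.
have P_dvd j : 'X^j %| P j.+1 - P j.
  have [h1 h2] := iter_dvdXn j.
  have -> : P j.+1 - P j = ((iterates j.+1).1 - (iterates j).1) *
       (E%:P + (iterates j.+1).2) +
     (D%:P + (iterates j).1) * ((iterates j.+1).2 - (iterates j).2).
    by rewrite /P; ring.
  by apply: dvdp_add; [exact: dvdp_mulr|exact: dvdp_mull].
have M'0 : 0 <= (normc D + rho) * (normc E + rho).
  by rewrite mulr_ge0 // addr_ge0 ?normc_ge0 ?ltW.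
have [W [hW [w hw]]] := poly_seq_limit rp M'0 P_bound P_dvd.
have tz z : normc z < r -> 0 <= normc z / r < 1 /\ normc z <= normc z / r * r.
  move=> zr; rewrite divr_ge0 ?normc_ge0 //= ltr_pdivrMr // mul1r zr divfK //.
  by rewrite gt_eqF.
have cU z : normc z < r -> ccvg (fun j => (iterates j).1.[z]) (U z).
  move=> /tz[h1 h2]; apply: (ccvg_geometric h1) => n; exact: hU.
have cV z : normc z < r -> ccvg (fun j => (iterates j).2.[z]) (V z).
  move=> /tz[h1 h2]; apply: (ccvg_geometric h1) => n; exact: hV.
have cW z : normc z < r -> ccvg (fun j => (P j).[z]) (W z).
  move=> /tz[h1 h2]; apply: (ccvg_geometric h1) => n; exact: hW.
have WE z : normc z < r -> W z = (D + U z) * (E + V z).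
  move=> zr; apply: (ccvg_unique (cW z zr)).
  rewrite (_ : (fun j => _) = fun j => (D + (iterates j).1.[z]) * (E + (iterates j).2.[z])).
    by apply: ccvgM; apply: ccvgD; auto; exact: ccvg_cst.
  by apply/funext => j; rewrite /P hornerM !hornerD !hornerC.
have horner_le p z : pnorm r p <= rho -> normc z < r -> normc p.[z] <= rho.
  move=> hp zr; apply: le_trans hp.
  have := @horner_pnorm _ r p z 1 0 r0; rewrite expr0 mulr1 mul1r; apply => //.
    by rewrite ler01 lexx.
  exact: ltW.
have lim_le (u : nat -> R[i]) l (b : R) : (forall n, normc (u n) <= b) -> ccvg u l -> normc l <= b.
  move=> hu cu; apply/ler_addgt0Pr => e e0.
  have [N _ /(_ N (leqnn N))] := (cvgr0_norm_lt _ cu) _ e0.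
  rewrite /= ger0_norm ?normc_ge0 // normcBC => h.
  have -> : l = u N + (l - u N) by ring.
  by apply: le_trans (normcD _ _) _; rewrite lerD ?hu // ltW.
(* Truncation order and argument move together: the truncation error is at most [B * 2^-1 ^+ n]
   uniformly in the argument, and the Lipschitz bound controls the rest. *)
have cS (a : nat -> R[i]) F (u : nat -> R[i]) l :
    (forall w n, normc w <= rho0 ->
      normc (\sum_(k < n) a k * w ^+ k.+2 - F w) <= B * 2^-1 ^+ n) ->
    (forall w w', normc w <= rho0 -> normc w' <= rho0 ->
      normc (F w - F w') <= L * normc (w - w')) ->
    (forall n, normc (u n) <= rho) -> ccvg u l ->
    ccvg (fun n => \sum_(k < n) a k * u n ^+ k.+2) (F l).
  move=> hs hlip hu cu.
  have u0 n : normc (u n) <= rho0 by exact: le_trans (hu n) rho_le0.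
  have l0 : normc l <= rho0 by exact: lim_le _ _ _ u0 cu.
  apply: (@ccvg_le _ _ _ (fun n => B * 2^-1 ^+ n + L * normc (u n - l))).
    move=> n; rewrite -(subrKA (F (u n))); apply: le_trans (normcD _ _) _.
    by rewrite lerD ?hs ?hlip.
  rewrite -[X in _ --> X](addr0 0); apply: cvgD.
    by apply: cvg_geometric; rewrite ger0_norm ?invr_ge0 // invf_lt1 // ltr1n.
  by rewrite -[X in _ --> X](mulr0 L); apply: cvgM => //; exact: cvg_cst.
exists r => //; exists U, V, w; split; last first.
  move=> s zs z sr hzs hz cz.
  have zr : normc z < r by exact: le_lt_trans _ sr.
  have zsr n : normc (zs n) < r by exact: le_lt_trans _ sr.
  rewrite -WE // (_ : (fun n => _) = fun n => W (zs n)).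
    exact: (poly_limit_continuous rp hW sr hzs hz cz).
  by apply/funext => n; rewrite WE.
move=> z zr.
have hR1 : ccvg (fun j => (R1 j (iterates j)).[z]) (Fa (V z) - z * (D + U z)).
  rewrite (_ : (fun j => _) = fun j => (\sum_(k < j) al k * (iterates j).2.[z] ^+ k.+2)
      + (- z) * (D + (iterates j).1.[z])).
    rewrite -mulNr; apply: ccvgD.
      apply: cS; [exact: Fa_series|exact: Fa_lip| |exact: cV].
      by move=> n; apply: horner_le => //; exact: (bound n).2.
    apply: ccvgM; first exact: ccvg_cst.
    by apply: ccvgD; [exact: ccvg_cst|exact: cU].
  apply/funext => j; rewrite /R1 hornerD hornerN hornerM hornerX hornerD hornerC mulNr.
  congr (_ - _); rewrite horner_sum; apply: eq_bigr => k _.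
  by rewrite hornerZ horner_exp.
have hR2 : ccvg (fun j => (R2 j (iterates j)).[z]) (Fb (U z) - z * (E + V z)).
  rewrite (_ : (fun j => _) = fun j => (\sum_(k < j) be k * (iterates j).1.[z] ^+ k.+2)
      + (- z) * (E + (iterates j).2.[z])).
    rewrite -mulNr; apply: ccvgD.
      apply: cS; [exact: Fb_series|exact: Fb_lip| |exact: cU].
      by move=> n; apply: horner_le => //; exact: (bound n).1.
    apply: ccvgM; first exact: ccvg_cst.
    by apply: ccvgD; [exact: ccvg_cst|exact: cV].
  apply/funext => j; rewrite /R2 hornerD hornerN hornerM hornerX hornerD hornerC mulNr.
  congr (_ - _); rewrite horner_sum; apply: eq_bigr => k _.
  by rewrite hornerZ horner_exp.
have fix_eq a b (u : nat -> {poly R[i]}) l : ccvg (fun j => (u j).[z]) l ->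
    (forall j, u j.+1 = a *: R1 j (iterates j) + b *: R2 j (iterates j)) ->
    l = a * (Fa (V z) - z * (D + U z)) + b * (Fb (U z) - z * (E + V z)).
  move=> cu uE; apply: (@ccvg_unique _ (fun j => (u j.+1).[z])).
    by rewrite /ccvg (cvg_shiftS (fun n => normc ((u n).[z] - l))).
  rewrite (_ : (fun j => _) = fun j => a * (R1 j (iterates j)).[z] +
    b * (R2 j (iterates j)).[z]).
    by apply: ccvgD; apply: ccvgM => //; exact: ccvg_cst.
  by apply/funext => j; rewrite uE hornerD !hornerZ.
split.
- apply: (le_trans _ rho_le0); apply: (lim_le _ _ _ _ (cU z zr)) => n.
  by apply: horner_le => //; exact: (bound n).1.
- apply: (le_trans _ rho_le0); apply: (lim_le _ _ _ _ (cV z zr)) => n.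
  by apply: horner_le => //; exact: (bound n).2.
- exact: (fix_eq _ _ (fun j => (iterates j).1)) (cU z zr) _.
- exact: (fix_eq _ _ (fun j => (iterates j).2)) (cV z zr) _.
- by rewrite -WE //; exact: hw.
Qed.

End AnalyticSystemSolution.

(** * Integrals of bounded functions against a probability *)

Section Integral.
Context {R : realType} (P : probability R R).
Implicit Types (f g : R -> R) (F G : R -> R[i]).

(** Boundedness against a probability gives integrability at once, so [Rintegral] is linear on this
    class; for [b] in the upper half plane all kernels belong to it. *)
Definition bounded_measurable g :=
  measurable_fun setT g /\ exists M : R, forall t, `|g t| <= M.

Local Notation bm := bounded_measurable.

Lemma bounded_measurable_integrable g : bm g -> P.-integrable setT (EFin \o g).
Proof.
move=> [mg [M hM]]; apply: measurable_bounded_integrable => //.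
  by apply: le_lt_trans (probability_le1 P measurableT) _; rewrite ltry.
exists M; split; first exact: num_real.
by move=> x Mx t _; apply: le_trans (hM t) (ltW Mx).
Qed.

Lemma bounded_measurable_cst r : bm (fun=> r).
Proof. by split; [exact: measurable_cst|exists `|r|]. Qed.

Lemma bounded_measurableD f g : bm f -> bm g -> bm (fun t => f t + g t).
Proof.
move=> [mf [M hM]] [mg [N hN]]; split; first exact: measurable_funD.
by exists (M + N) => t; apply: le_trans (ler_normD _ _) _; rewrite lerD.
Qed.

Lemma bounded_measurableM f g : bm f -> bm g -> bm (fun t => f t * g t).
Proof.
move=> [mf [M hM]] [mg [N hN]]; split; first exact: measurable_funM.
by exists (M * N) => t; rewrite normrM ler_pM.
Qed.

Lemma bounded_measurable_sqr f : bm f -> bm (fun t => f t ^+ 2).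
Proof. by move=> hf; under eq_fun do rewrite expr2; exact: bounded_measurableM. Qed.

Lemma bounded_measurable_indic A : measurable A -> bm (\1_A).
Proof.
move=> mA; split; first exact: measurable_indic.
by exists 1 => t; rewrite indicE; case: (t \in A); rewrite ?normr1 ?normr0.
Qed.

Lemma Rintegral_bmD f g : bm f -> bm g ->
  \int[P]_t (f t + g t) = \int[P]_t f t + \int[P]_t g t.
Proof. by move=> hf hg; apply: RintegralD => //; exact: bounded_measurable_integrable. Qed.

Lemma Rintegral_bmZ r f : bm f -> \int[P]_t (r * f t) = r * \int[P]_t f t.
Proof. by move=> hf; apply: RintegralZl => //; exact: bounded_measurable_integrable. Qed.

Lemma Rintegral_prob_cst r : \int[P]_t (cst r t) = r.
Proof.
rewrite Rintegral_cst // -[RHS]mulr1; congr (_ * _).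
by rewrite -[RHS]/(fine 1%E); congr fine; exact: probability_setT.
Qed.

Lemma Rintegral_bm_indic A : measurable A -> \int[P]_t (\1_A t) = fine (P A).
Proof. by move=> mA; rewrite /Rintegral integral_indic // setIT. Qed.

Definition on_nneg := P [set t : R | t < 0] = 0%E.

(** The negative half-line is null, so a pointwise comparison may use the sign of [t]. *)
Lemma le_Rintegral_nneg f g : on_nneg -> bm f -> bm g ->
  (forall t, 0 <= t -> f t <= g t) -> \int[P]_t f t <= \int[P]_t g t.
Proof.
move=> P0 bf bg fg.
have mN : measurable [set t : R | t < 0].
  by rewrite -set_itvNyo; exact: measurable_itv.
have red h : bm h -> \int[P]_t h t = \int[P]_(t in setT `\` [set t : R | t < 0]) h t.
  move=> bh; rewrite /Rintegral; congr fine.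
  by apply: negligible_integral => //; exact: bounded_measurable_integrable.
rewrite (red f) // (red g) //; apply: le_Rintegral => //.
- exact: measurableD.
- by apply: integrableS (bounded_measurable_integrable bf) => //; exact: measurableD.
- by apply: integrableS (bounded_measurable_integrable bg) => //; exact: measurableD.
- by move=> t [_ /= /negP]; rewrite -leNgt => /fg.
Qed.

(** Nonnegativity of the variance. *)
Lemma sqr_Rintegral_le f : bm f -> (\int[P]_t f t) ^+ 2 <= \int[P]_t (f t ^+ 2).
Proof.
move=> bf; set s := \int[P]_t f t.
have : 0 <= \int[P]_t ((f t - s) ^+ 2) by apply: Rintegral_ge0 => t _; exact: sqr_ge0.
have -> : \int[P]_t ((f t - s) ^+ 2) =
    \int[P]_t (f t ^+ 2 + (- 2 * s * f t + cst (s ^+ 2) t)).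
  by apply: eq_Rintegral => t _; rewrite /=; ring.
have b2 : bm (fun t => - 2 * s * f t).
  exact: bounded_measurableM (bounded_measurable_cst _) bf.
have b3 := bounded_measurable_cst (s ^+ 2).
rewrite Rintegral_bmD; last 2 first.
- exact: bounded_measurable_sqr.
- exact: bounded_measurableD.
rewrite Rintegral_bmD // Rintegral_bmZ // Rintegral_prob_cst -/s.
by move: (\int[P]_t _) => Q; nra.
Qed.

Definition cbounded_measurable F :=
  [/\ measurable_fun setT (fun t => complex.Re (F t)),
      measurable_fun setT (fun t => complex.Im (F t)) &
      exists M : R, forall t, normc (F t) <= M].

Local Notation cbm := cbounded_measurable.

Lemma cbm_Re F : cbm F -> bm (fun t => complex.Re (F t)).
Proof.
by move=> [? ? [M hM]]; split=> //; exists M => t; apply: le_trans (le_normc_Re _) _.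
Qed.

Lemma cbm_Im F : cbm F -> bm (fun t => complex.Im (F t)).
Proof.
by move=> [? ? [M hM]]; split=> //; exists M => t; apply: le_trans (le_normc_Im _) _.
Qed.

Lemma cbm_sqr_normc F : cbm F -> bm (fun t => normc (F t) ^+ 2).
Proof.
move=> hF; under eq_fun do rewrite sqr_normcE.
by apply: bounded_measurableD; apply: bounded_measurable_sqr;
  [exact: cbm_Re|exact: cbm_Im].
Qed.

Lemma cbm_cst c : cbm (fun=> c).
Proof. by split; [exact: measurable_cst|exact: measurable_cst|exists (normc c)]. Qed.

Lemma cbmM F G : cbm F -> cbm G -> cbm (fun t => F t * G t).
Proof.
move=> [rF iF [M hM]] [rG iG [N hN]]; split.
- by under eq_fun do rewrite ReM; apply: measurable_funB; exact: measurable_funM.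
- by under eq_fun do rewrite ImM; apply: measurable_funD; exact: measurable_funM.
- by exists (M * N) => t; rewrite normcM ler_pM ?normc_ge0.
Qed.

Lemma cbmX F n : cbm F -> cbm (fun t => F t ^+ n).
Proof.
move=> hF; elim: n => [|n IH].
  by under eq_fun do rewrite expr0; exact: cbm_cst.
by under eq_fun do rewrite exprS; exact: cbmM.
Qed.

Lemma cbmZ c F : cbm F -> cbm (fun t => c * F t).
Proof. by move=> hF; apply: cbmM => //; exact: cbm_cst. Qed.

Lemma eq_cintegral F G : (forall t, F t = G t) -> cintegral P F = cintegral P G.
Proof. by move=> h; congr (cintegral P _); apply/funext. Qed.

Lemma cintegralD F G : cbm F -> cbm G ->
  cintegral P (fun t => F t + G t) = cintegral P F + cintegral P G.
Proof.
move=> hF hG; rewrite /cintegral; apply: complex_ext => /=.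
  rewrite -Rintegral_bmD; [|exact: cbm_Re|exact: cbm_Re].
  by apply: eq_Rintegral => t _; rewrite ReD.
rewrite -Rintegral_bmD; [|exact: cbm_Im|exact: cbm_Im].
by apply: eq_Rintegral => t _; rewrite ImD.
Qed.

Lemma cintegralZ c F : cbm F -> cintegral P (fun t => c * F t) = c * cintegral P F.
Proof.
move=> hF; have hr := cbm_Re hF; have hi := cbm_Im hF.
have bc r f : bm f -> bm (fun t => r * f t).
  by move=> hf; apply: bounded_measurableM => //; exact: bounded_measurable_cst.
rewrite /cintegral; apply: complex_ext; rewrite ?ReM ?ImM /=.
  rewrite -mulNr -!Rintegral_bmZ // -Rintegral_bmD; [|exact: bc|exact: bc].
  by apply: eq_Rintegral => t _; rewrite ReM mulNr.
rewrite -!Rintegral_bmZ // -Rintegral_bmD; [|exact: bc|exact: bc].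
by apply: eq_Rintegral => t _; rewrite ImM.
Qed.

Lemma cintegral_cst c : cintegral P (fun=> c) = c.
Proof. by apply: complex_ext; exact: (Rintegral_prob_cst _). Qed.

Lemma Re_cintegral F : complex.Re (cintegral P F) = \int[P]_t complex.Re (F t).
Proof. by []. Qed.

Lemma Im_cintegral F : complex.Im (cintegral P F) = \int[P]_t complex.Im (F t).
Proof. by []. Qed.

(** Multiplying by the conjugate of the integral rotates it to the positive axis, where only real
    parts are compared. *)
Lemma normc_cintegral_le F g : on_nneg -> cbm F -> bm g ->
  (forall t, 0 <= t -> normc (F t) <= g t) ->
  normc (cintegral P F) <= \int[P]_t g t.
Proof.
move=> P0 hF hg hFg; set I := cintegral P F.
have Jg0 : 0 <= \int[P]_t g t.
  rewrite -(Rintegral_prob_cst 0); apply: le_Rintegral_nneg => //.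
    exact: bounded_measurable_cst.
  by move=> t t0; apply: le_trans (hFg t t0); exact: normc_ge0.
have [->|I0] := eqVneq I 0; first by rewrite normc0.
have nI : 0 < normc I by rewrite normc_gt0.
rewrite -(ler_pM2l nI) -expr2.
have -> : normc I ^+ 2 = complex.Re (conjc I * I).
  by rewrite sqr_normcE; case: (I) => a b /=; ring.
rewrite -cintegralZ // Re_cintegral -Rintegral_bmZ //.
apply: le_Rintegral_nneg => //.
- by apply: cbm_Re; exact: cbmZ.
- by apply: bounded_measurableM => //; exact: bounded_measurable_cst.
move=> t t0; apply: le_trans (ler_norm _) _; apply: le_trans (le_normc_Re _) _.
by rewrite normcM normc_conjc ler_wpM2l ?hFg ?normc_ge0.
Qed.

Lemma normc_cintegral_bound F M : on_nneg -> cbm F ->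
  (forall t, normc (F t) <= M) -> normc (cintegral P F) <= M.
Proof.
move=> P0 hF h; rewrite -(Rintegral_prob_cst M).
by apply: normc_cintegral_le => //; exact: bounded_measurable_cst.
Qed.

End Integral.

(** * The kernel t / (1 + b t) and its integrals *)

Section Kernel.
Context {R : realType}.
Implicit Types (b w z : R[i]) (t : R).

Definition resolvent b t : R[i] := (1 + b * t%:C)^-1.
Definition kernel b t : R[i] := t%:C / (1 + b * t%:C).

Lemma normc_den_geM b t : 0 <= complex.Im b ->
  complex.Im b * `|t| <= normc (1 + b * t%:C).
Proof.
move=> b0; apply: le_trans (le_normc_Im _).
by rewrite ImD ImM /= mulr0 !add0r normrM (ger0_norm b0).
Qed.

(** Multiplication by [conjc b] makes the term in [t] real, so the imaginary part is [- Im b] for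
    every [t]. *)
Lemma normc_den_ge b t : complex.Im b <= normc b * normc (1 + b * t%:C).
Proof.
rewrite -(normc_conjc b) -normcM; apply: le_trans (le_normc_Im _).
apply: le_trans (ler_norm _) _; rewrite -normrN le_eqVlt; apply/orP; left.
by apply/eqP; congr `|_|; case: b => x y /=; ring.
Qed.

Lemma den_neq0 b t : 0 < complex.Im b -> 1 + b * t%:C != 0.
Proof.
move=> b0; apply/eqP => h; have := normc_den_ge b t.
by rewrite h normc0 mulr0 leNgt b0.
Qed.

Lemma normc_resolvent_le b t : 0 < complex.Im b ->
  normc (resolvent b t) <= normc b / complex.Im b.
Proof.
move=> b0; rewrite /resolvent normcV ler_pdivlMr // mulrC ler_pdivrMr.
  exact: normc_den_ge.
by rewrite normc_gt0 den_neq0.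
Qed.

Lemma kernelE b t : kernel b t = t%:C * resolvent b t.
Proof. by []. Qed.

Lemma normc_kernel_le b t : 0 < complex.Im b ->
  normc (kernel b t) <= (complex.Im b)^-1.
Proof.
move=> b0; rewrite /kernel normcM normcV normcr.
rewrite ler_pdivrMr ?normc_gt0 ?den_neq0 // mulrC ler_pdivlMr // mulrC.
by apply: normc_den_geM; exact: ltW.
Qed.

(** The source of the energy identities: integrated, it expresses the imaginary part of the
    transform by an L^2 norm. *)
Lemma Im_kernel b t : complex.Im (kernel b t) = - complex.Im b * normc (kernel b t) ^+ 2.
Proof.
rewrite /kernel ImM ImV Im_real mul0r addr0 normcM normcV normcr exprMn exprVn.
rewrite real_normK ?num_real // ImD ImM !Im_real Re_real /= mulr0 !add0r.
ring.
Qed.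

(** The resolvent identity; iterating it yields the Taylor expansion in [w]. *)
Lemma kernel_shift b w t : 0 < complex.Im b -> 0 < complex.Im (b + w) ->
  kernel (b + w) t = kernel b t - w * (kernel b t * kernel (b + w) t).
Proof.
move=> /(den_neq0 t) h1 /(den_neq0 t) h2; rewrite /kernel.
by field; rewrite h1 h2.
Qed.

Lemma mul_kernel b t : 0 < complex.Im b -> b * kernel b t = 1 - resolvent b t.
Proof.
by move=> /(den_neq0 t) h; rewrite /kernel /resolvent; field.
Qed.

Lemma continuous_affine (x y : R) : continuous (fun t : R => x + y * t).
Proof.
move=> t; apply: cvgD; first exact: cvg_cst.
by apply: cvgM; [exact: cvg_cst|exact: cvg_id].
Qed.

Lemma cbm_resolvent b : 0 < complex.Im b -> cbounded_measurable (resolvent b).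
Proof.
move=> b0.
pose r t := 1 + complex.Re b * t; pose i t := 0 + complex.Im b * t.
have qE t : normc (1 + b * t%:C) ^+ 2 = r t * r t + i t * i t.
  by rewrite sqr_normcE ReD ImD ReM ImM /= !mulr0 subr0 !add0r /r /i !expr2 add0r.
have mr : measurable_fun setT r.
  by apply: continuous_measurable_fun; exact: continuous_affine.
have mi : measurable_fun setT i.
  by apply: continuous_measurable_fun; exact: continuous_affine.
have mq : measurable_fun setT (fun t => (r t * r t + i t * i t)^-1).
  apply: continuous_measurable_fun => t; apply: cvgV.
    by rewrite -qE expf_eq0 /= normc_eq0 den_neq0.
  apply: cvgD; apply: cvgM; exact: continuous_affine.
split.
- rewrite (_ : (fun t => _) = fun t => r t * (r t * r t + i t * i t)^-1).
    exact: measurable_funM.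
  apply/funext => t; rewrite /resolvent ReV qE; congr (_ / _).
  by rewrite ReD ReM /= mulr0 subr0.
- rewrite (_ : (fun t => _) = fun t => - (i t * (r t * r t + i t * i t)^-1)).
    by apply: measurable_funN; exact: measurable_funM.
  apply/funext => t; rewrite /resolvent ImV qE mulNr; congr (- (_ / _)).
  by rewrite ImD ImM /= mulr0 add0r /i !add0r.
- by exists (normc b / complex.Im b) => t; exact: normc_resolvent_le.
Qed.

Lemma cbm_kernel b : 0 < complex.Im b -> cbounded_measurable (kernel b).
Proof.
move=> b0; have [mr mi _] := cbm_resolvent b0.
have mt : measurable_fun setT (fun t : R => t) by exact: measurable_id.
split.
- under eq_fun do rewrite kernelE ReM Re_real Im_real mul0r subr0.
  exact: measurable_funM.
- under eq_fun do rewrite kernelE ImM Re_real Im_real mul0r addr0.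
  exact: measurable_funM.
- by exists (complex.Im b)^-1 => t; exact: normc_kernel_le.
Qed.

End Kernel.

(** * Tails and mass away from zero *)

Section Nondegenerate.
Context {R : realType} (P : probability R R).
Hypothesis P0 : on_nneg P.

Lemma exists_tail_le (e : R) : 0 < e ->
  exists2 K : R, 0 < K & \int[P]_t (\1_(`]K, +oo[ : set R) t) <= e.
Proof.
move=> e0; pose F (n : nat) : set R := `]n.+1%:R, +oo[%classic.
have mF n : measurable (F n) by exact: measurable_itv.
have capF : \bigcap_n F n = set0.
  apply/seteqP; split => // t /(_ (Num.truncn `|t|)) /= /(_ I).
  rewrite /F /= in_itv /= andbT => h.
  have := truncnS_gt `|t|; rewrite ltNge => /negP; apply.
  by apply: le_trans (ltW h) (ler_norm _).
have PF : (P (F 0%N) < +oo)%E.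
  by apply: le_lt_trans (probability_le1 P (mF _)) _; rewrite ltry.
have niF : nonincreasing_seq F.
  apply/nonincreasing_seqP => n; apply/subsetPset => t.
  rewrite /F /= !in_itv /= !andbT; apply: le_lt_trans.
  by rewrite ler_nat.
have := nonincreasing_cvg_mu PF mF; rewrite capF => /(_ measurable0 niF).
rewrite measure0 => /fine_cvgP[_ /(cvgr0_norm_lt _) /(_ _ e0)[N _ hN]].
exists N.+1%:R; first exact: ltr0Sn.
rewrite Rintegral_bm_indic //; apply: le_trans (ler_norm _) _.
by apply: ltW; exact: hN (leqnn N).
Qed.

(** If all these segments were null, so would be the positive half-line, and a probability on the
    nonnegative reals carried by [0] is the Dirac mass. *)
Lemma exists_mass_segment :
  ~ (forall A, measurable A -> P A = \d_(0 : R) A) ->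
  exists K : R, 1 <= K /\ 0 < \int[P]_t (\1_(`[K^-1, K] : set R) t).
Proof.
move=> ndeg; apply: contrapT => hK; apply: ndeg.
pose F (n : nat) : set R := `[n.+1%:R^-1, n.+1%:R]%classic.
have mF n : measurable (F n) by exact: measurable_itv.
have PF n : P (F n) = 0%E.
  apply/eqP; rewrite eq_le measure_ge0 andbT leNgt; apply/negP => h.
  apply: hK; exists n.+1%:R; split; first by rewrite ler1n.
  rewrite Rintegral_bm_indic // fine_gt0 // h /=.
  by apply: le_lt_trans (probability_le1 P (mF _)) _; rewrite ltry.
have mneg : measurable [set t : R | t < 0].
  by rewrite -set_itvNyo; exact: measurable_itv.
have nul : P.-negligible (~` [set 0 : R]).
  apply: (@negligibleS _ _ _ _ ([set t : R | t < 0] `|` \bigcup_n F n)).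
    move=> t /= /eqP t0; case: (ltP t 0) => [|tge]; first by left.
    have tp : 0 < t by rewrite lt_neqAle eq_sym t0.
    right; exists (maxn (Num.truncn t) (Num.truncn t^-1)) => //.
    rewrite /F /= in_itv /=; apply/andP; split.
      rewrite invf_ple ?posrE ?ltr0Sn //; apply: ltW.
      by apply: lt_le_trans (truncnS_gt _) _; rewrite ler_nat ltnS leq_maxr.
    by apply: ltW; apply: lt_le_trans (truncnS_gt _) _; rewrite ler_nat ltnS leq_maxl.
  apply: negligibleU; first by exists [set t : R | t < 0]; split.
  apply: negligible_bigcup => n; exists (F n); split => //; exact: PF.
have null (A : set R) : measurable A -> ~ A 0 -> P A = 0%E.
  move=> mA A0; apply/(negligibleP P mA); apply: negligibleS nul => t At /= t0.
  by apply: A0; rewrite -t0.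
move=> A mA; rewrite diracE; case: (boolP (0 \in A)) => [/set_mem A0|/negP A0].
  have h : P (~` A) = 0%E by apply: null => //; exact: measurableC.
  have := probability_setC P (measurableC mA).
  by rewrite setCK h sube0.
by rewrite null // => h; apply: A0; exact: mem_set.
Qed.

End Nondegenerate.

(** * The transform, its moments and its energy *)

Section Transform.
Context {R : realType} (P : probability R R).
Hypothesis P0 : on_nneg P.
Implicit Types (b w z : R[i]) (t : R).

Definition ktrans b : R[i] := cintegral P (kernel b).
(** The index is shifted: [kmoment b 0] is [ktrans b], [kmoment b 1] is minus its derivative, and
    [(-1) ^+ k * kmoment b k] is its Taylor coefficient of order [k]. *)
Definition kmoment b k : R[i] := cintegral P (fun t => kernel b t ^+ k.+1).
Definition kenergy b : R := \int[P]_t (normc (kernel b t) ^+ 2).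

Lemma kenergy_ge0 b : 0 <= kenergy b.
Proof. by apply: Rintegral_ge0 => t _; exact: sqr_ge0. Qed.

Lemma Im_ktrans b : 0 < complex.Im b ->
  complex.Im (ktrans b) = - complex.Im b * kenergy b.
Proof.
move=> b0; rewrite Im_cintegral /kenergy -Rintegral_bmZ.
  by apply: eq_Rintegral => t _; rewrite Im_kernel.
by apply: cbm_sqr_normc; exact: cbm_kernel.
Qed.

Lemma mul_ktrans b : 0 < complex.Im b ->
  b * ktrans b = 1 - cintegral P (resolvent b).
Proof.
move=> b0; rewrite -cintegralZ; last exact: cbm_kernel.
rewrite (@eq_cintegral _ _ _ (fun t => 1 + -1 * resolvent b t)).
  rewrite cintegralD ?cintegralZ ?cintegral_cst ?mulN1r //.
  - exact: cbm_resolvent.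
  - exact: cbm_cst.
  - by apply: cbmZ; exact: cbm_resolvent.
by move=> t; rewrite mul_kernel // mulN1r.
Qed.

Lemma normc_kmoment_le b k : 0 < complex.Im b ->
  normc (kmoment b k) <= (complex.Im b)^-1 ^+ k.+1.
Proof.
move=> b0; apply: normc_cintegral_bound => //; first by apply: cbmX; exact: cbm_kernel.
move=> t; rewrite normcX lerXn2r ?nnegrE ?normc_ge0 ?invr_ge0 ?(ltW b0) //.
exact: normc_kernel_le.
Qed.

(** Iterating [kernel_shift] under the integral leaves one explicit remainder, estimated by the sup
    bounds of the two kernels. *)
Lemma ktrans_expansion b w n : 0 < complex.Im b -> 0 < complex.Im (b + w) ->
  normc (ktrans (b + w) - \sum_(k < n) (- w) ^+ k * kmoment b k)
    <= (normc w / complex.Im b) ^+ n / complex.Im (b + w).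
Proof.
move=> b0 bw0; have kb := cbm_kernel b0; have kbw := cbm_kernel bw0.
pose rest k := cintegral P (fun t => kernel b t ^+ k * kernel (b + w) t).
have restS k : rest k = kmoment b k - w * rest k.+1.
  have h j : cbounded_measurable (fun t => kernel b t ^+ j * kernel (b + w) t).
    by apply: cbmM => //; exact: cbmX.
  rewrite /rest -mulNr -cintegralZ // -cintegralD; last 2 first.
  - exact: cbmX.
  - exact: cbmZ.
  apply: eq_cintegral => t; rewrite {1}kernel_shift // !exprSr; ring.
have -> : ktrans (b + w) = \sum_(k < n) (- w) ^+ k * kmoment b k + (- w) ^+ n * rest n.
  elim: n => [|n IH].
    rewrite big_ord0 add0r expr0 mul1r.
    by apply: eq_cintegral => t; rewrite expr0 mul1r.
  by rewrite IH big_ord_recr /= (restS n) exprSr; ring.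
rewrite addrC addKr normcM normcX normc_opp expr_div_n -!mulrA.
rewrite ler_wpM2l ?exprn_ge0 ?normc_ge0 //.
apply: normc_cintegral_bound => //; first by apply: cbmM => //; exact: cbmX.
move=> t; rewrite normcM normcX -exprVn ler_pM ?exprn_ge0 ?normc_ge0 //.
  by rewrite lerXn2r ?nnegrE ?normc_ge0 ?invr_ge0 ?(ltW b0) // normc_kernel_le.
exact: normc_kernel_le.
Qed.

Lemma ktrans_lipschitz b b' : 0 < complex.Im b -> 0 < complex.Im b' ->
  normc (ktrans b' - ktrans b) <= normc (b' - b) / (complex.Im b * complex.Im b').
Proof.
move=> b0 b'0; have bw : b + (b' - b) = b' by ring.
have := @ktrans_expansion b (b' - b) 1 b0; rewrite bw => /(_ b'0).
rewrite big_ord1 expr0 mul1r expr1 invfM mulrA; apply: le_trans.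
by rewrite le_eqVlt; apply/orP; left; apply/eqP; congr (normc (_ - _)).
Qed.

Lemma kenergy_lower_bound :
  ~ (forall A, measurable A -> P A = \d_(0 : R) A) ->
  exists2 k : R, 0 < k &
    forall b, 0 < complex.Im b -> k / (1 + normc b) ^+ 2 <= kenergy b.
Proof.
move=> /exists_mass_segment -/(_ P0)[K [K1 pK]].
set p := \int[P]_t _ in pK.
have K0 : 0 < K by exact: lt_le_trans K1.
(* From [t >= K^-1] and [normc (1 + b * t%:C) <= K * (1 + normc b)], valid as [1 <= K], the kernel
   has modulus at least [K ^- 2 / (1 + normc b)] on the segment, whose mass is [p]. *)
exists (p * (K ^+ 2)^-1 ^+ 2); first by rewrite mulr_gt0 // exprn_gt0 // invr_gt0 exprn_gt0.
move=> b b0; have nb := normc_ge0 b; have nb1 : 0 < 1 + normc b by rewrite ltr_pwDl.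
pose q := ((K ^+ 2)^-1 / (1 + normc b)) ^+ 2.
have -> : p * (K ^+ 2)^-1 ^+ 2 / (1 + normc b) ^+ 2 = q * p.
  by rewrite /q expr_div_n -mulrA mulrC.
have mI : measurable (`[K^-1, K] : set R) by exact: measurable_itv.
have bI := bounded_measurable_indic mI.
rewrite /p -Rintegral_bmZ //; apply: le_Rintegral_nneg => //.
- by apply: bounded_measurableM => //; exact: bounded_measurable_cst.
- by apply: cbm_sqr_normc; exact: cbm_kernel.
move=> t t0; rewrite indicE; case: (boolP (t \in _)) => [|_]; last first.
  by rewrite mulr0 sqr_ge0.
rewrite inE /= in_itv /= => /andP[tK1 tK]; rewrite mulr1 /q.
have q0 : 0 <= (K ^+ 2)^-1 / (1 + normc b).
  by rewrite divr_ge0 ?(ltW nb1) // invr_ge0 exprn_ge0 // ltW.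
rewrite lerXn2r ?nnegrE ?normc_ge0 //.
rewrite /kernel normcM normcV normcr (ger0_norm t0).
rewrite ler_pdivlMr ?normc_gt0 ?den_neq0 //.
apply: le_trans tK1.
have hden : normc (1 + b * t%:C) <= K * (1 + normc b).
  apply: le_trans (normcD _ _) _; rewrite normc1 normcM normcr (ger0_norm t0).
  rewrite mulrDr mulr1 lerD // mulrC; exact: ler_wpM2r.
apply: le_trans (ler_wpM2l q0 hden) _.
rewrite le_eqVlt; apply/orP; left; apply/eqP; field.
by rewrite !gt_eqF.
Qed.

(** Under the energy bound, [b * ktrans b] tends to [0] with [b] even without a first moment: up to
    [K] the integrand has size [normc b * K], and beyond [K] the energy is weighed against the small
    tail mass. *)
Lemma small_ktrans (C s : R) : 0 < C -> 0 < s ->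
  exists2 be : R, 0 < be & forall b, 0 < complex.Im b ->
    normc b ^+ 2 * kenergy b <= C -> s <= normc (b * ktrans b) -> be <= normc b.
Proof.
(* [e] fits the energy term into [s / 4], and tail mass at most [e * s / 4] does so for the tail;
   [normc b * K <= s / 16] leaves [s / 8] for the bounded part, where [normc b * K <= 2^-1] keeps
   the denominator above one half. *)
move=> C0 s0; pose e := s / (4 * C).
have e0 : 0 < e by rewrite divr_gt0 // mulr_gt0.
have [|K K0 hK] := exists_tail_le P (e := e * s / 4).
  by rewrite divr_gt0 // mulr_gt0.
pose be := Num.min (2^-1 / K) (s / (16 * K)).
have be0 : 0 < be by rewrite lt_min !divr_gt0 // mulr_gt0.
exists be => // b b0 hC hs; rewrite leNgt; apply/negP => hb.
have bK : normc b * K <= 2^-1.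
  by rewrite -ler_pdivlMr //; apply: ltW; apply: lt_le_trans hb _; rewrite ge_min lexx.
have bKs : normc b * K <= s / 16.
  rewrite -ler_pdivlMr // -mulrA -invfM; apply: ltW; apply: lt_le_trans hb _.
  by rewrite ge_min lexx orbT.
have kb := cbm_kernel b0.
have bsq := cbm_sqr_normc kb.
have mI : measurable (`]K, +oo[ : set R) by exact: measurable_itv.
have bI := bounded_measurable_indic mI.
have bc r f : bounded_measurable f -> bounded_measurable (fun t : R => r * f t : R).
  by move=> hf; apply: bounded_measurableM => //; exact: bounded_measurable_cst.
(* AM-GM off [[0, K]]: [|y| <= e |y|^2 + 1/e] *)
pose g t := cst (2 * (normc b * K)) t +
  (e * normc b ^+ 2 * normc (kernel b t) ^+ 2 + e^-1 * \1_(`]K, +oo[ : set R) t).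
have hg : normc (b * ktrans b) <= \int[P]_t g t.
  rewrite -cintegralZ //; apply: normc_cintegral_le => //.
  - exact: cbmZ.
  - apply: bounded_measurableD; first exact: bounded_measurable_cst.
    by apply: bounded_measurableD; exact: bc.
  move=> t t0; rewrite /g /= normcM.
  have y0 : 0 <= normc b * normc (kernel b t) by rewrite mulr_ge0 ?normc_ge0.
  rewrite -mulrA -exprMn indicE mem_setE in_itv /= andbT.
  have nbK : 0 <= normc b * K by rewrite mulr_ge0 ?normc_ge0 ?ltW.
  case: (ltP K t) => [_|tK].
    rewrite mulr1; set y := _ * normc _ in y0 *.
    have : e * y * 1 <= (e * y) ^+ 2 + 1 by nra.
    have ei : e * e^-1 = 1 by rewrite divff ?gt_eqF.
    move=> h; have {}h : y <= e * y ^+ 2 + e^-1.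
      by rewrite -(ler_pM2l e0) mulrDr ei; lra.
    by apply: le_trans h _; rewrite lerDr mulr_ge0.
  rewrite mulr0 addr0.
  have den : 2^-1 <= normc (1 + b * t%:C).
    have h1 : 1 = (1 + b * t%:C) - b * t%:C by ring.
    have := normcB (1 + b * t%:C) (b * t%:C); rewrite -h1 normc1 normcM normcr ger0_norm //.
    have : normc b * t <= normc b * K by rewrite ler_wpM2l ?normc_ge0.
    lra.
  have h : normc b * normc (kernel b t) <= 2 * (normc b * K).
    rewrite /kernel normcM normcV normcr ger0_norm // mulrA ler_pdivrMr ?normc_gt0 ?den_neq0 //.
    have : normc b * t <= normc b * K by rewrite ler_wpM2l ?normc_ge0.
    nra.
  by apply: le_trans h _; rewrite lerDl mulr_ge0 ?sqr_ge0 // ltW.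
have : \int[P]_t g t <= 3 / 4 * s.
  rewrite /g Rintegral_bmD; last 2 first.
  - exact: bounded_measurable_cst.
  - by apply: bounded_measurableD; exact: bc.
  rewrite Rintegral_prob_cst Rintegral_bmD ?Rintegral_bmZ //; [|exact: bc|exact: bc].
  have h1 : e * normc b ^+ 2 * kenergy b <= s / 4.
    rewrite -mulrA; apply: le_trans (ler_wpM2l (ltW e0) hC) _.
    by rewrite le_eqVlt; apply/orP; left; apply/eqP; rewrite /e; field; rewrite gt_eqF.
  have h2 : e^-1 * \int[P]_t (\1_(`]K, +oo[ : set R) t) <= s / 4.
    by rewrite mulrC ler_pdivrMr //; apply: le_trans hK _; lra.
  move: h1 h2 bKs; rewrite /kenergy; lra.
lra.
Qed.

(** Pointwise the imaginary part on the right is [t * (Im z + Im (z * b) * t)] over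
    [|z|^2 |1 + b t|^2]; the nonnegative contribution of [t * Im z] is dropped. *)
Lemma Im_ktrans_div_ge b z : 0 < complex.Im b -> 0 < complex.Im z ->
  complex.Im (z * b) / normc z ^+ 2 * kenergy b <= complex.Im (- z^-1 * ktrans b).
Proof.
move=> b0 z0; have kb := cbm_kernel b0.
have znz : z != 0 by apply: contraTneq z0 => ->; rewrite ltxx.
rewrite -cintegralZ // Im_cintegral /kenergy -Rintegral_bmZ; last exact: cbm_sqr_normc.
apply: le_Rintegral_nneg => //.
- by apply: bounded_measurableM; [exact: bounded_measurable_cst|exact: cbm_sqr_normc].
- by apply: cbm_Im; exact: cbmZ.
move=> t t0; set d := 1 + b * t%:C.
have dnz : d != 0 by exact: den_neq0.
have -> : - z^-1 * kernel b t = - t%:C * (z * d)^-1.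
  by rewrite /kernel -/d invfM; ring.
have -> : kernel b t = t%:C * d^-1 by [].
rewrite [X in _ <= X]ImM ImN Im_real oppr0 mul0r addr0 ReN Re_real ImV !normcM normcV normcr.
rewrite exprMn real_normK ?num_real // exprVn exprMn.
have -> : complex.Im (z * d) = complex.Im z + complex.Im (z * b) * t.
  by rewrite /d mulrDr mulr1 ImD mulrA [in LHS]ImM Re_real Im_real mulr0 add0r.
have zp : 0 < normc z ^+ 2 by rewrite exprn_gt0 // normc_gt0.
have dp : 0 < normc d ^+ 2 by rewrite exprn_gt0 // normc_gt0.
rewrite -subr_ge0; set A := normc z ^+ 2 in zp *; set B := normc d ^+ 2 in dp *.
have -> : - t * (- (complex.Im z + complex.Im (z * b) * t) / (A * B)) -
  complex.Im (z * b) / A * (t ^+ 2 / B) = t * complex.Im z / (A * B).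
  by field; rewrite !gt_eqF.
by rewrite divr_ge0 // mulr_ge0 // ltW.
Qed.

Lemma normc_kmoment1_le b : 0 < complex.Im b -> normc (kmoment b 1) <= kenergy b.
Proof.
move=> b0; apply: normc_cintegral_le => //.
- by apply: cbmX; exact: cbm_kernel.
- by apply: cbm_sqr_normc; exact: cbm_kernel.
by move=> t _; rewrite normcX.
Qed.

(* Equality case of [normc_kmoment1_le]: the phase of the kernel is constant. *)
Lemma ktrans_phase b (sg : R[i]) : 0 < complex.Im b -> normc sg = 1 ->
  kmoment b 1 = (kenergy b)%:C * sg ^+ 2 ->
  complex.Im (conjc sg * ktrans b) = 0.
Proof.
move=> b0 sg1 hA; have kb := cbm_kernel b0.
have ku : cbounded_measurable (fun t => conjc sg * kernel b t) by exact: cbmZ.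
rewrite -cintegralZ // Im_cintegral; apply/eqP; rewrite -sqrf_eq0 eq_le sqr_ge0 andbT.
apply: le_trans (sqr_Rintegral_le P (cbm_Im ku)) _.
have k2 : cbounded_measurable (fun t => kernel b t ^+ 2) by exact: cbmX.
(* Pointwise (Im u)^2 = (|u|^2 - Re (u^2)) / 2, and by hypothesis both terms integrate to half the
   energy. *)
have -> : \int[P]_t (complex.Im (conjc sg * kernel b t) ^+ 2) =
  \int[P]_t (2^-1 * normc (kernel b t) ^+ 2 +
     - 2^-1 * complex.Re (conjc sg ^+ 2 * kernel b t ^+ 2)).
  apply: eq_Rintegral => t _.
  have -> : normc (kernel b t) ^+ 2 = normc (conjc sg * kernel b t) ^+ 2.
    by rewrite [in RHS]normcM normc_conjc sg1 mul1r.
  rewrite -exprMn; case: (conjc sg * kernel b t) => x y.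
  by rewrite normc_Complex expr2 ReM /=; field.
have bRe := cbm_Re (cbmZ (conjc sg ^+ 2) k2).
have bN := cbm_sqr_normc kb.
have bc r f : bounded_measurable f -> bounded_measurable (fun t : R => r * f t : R).
  by move=> hf; apply: bounded_measurableM => //; exact: bounded_measurable_cst.
rewrite Rintegral_bmD ?Rintegral_bmZ //; [|exact: bc|exact: bc].
rewrite -Re_cintegral cintegralZ // -/(kmoment b 1) hA -/(kenergy b).
have -> : conjc sg ^+ 2 * ((kenergy b)%:C * sg ^+ 2) = (kenergy b)%:C.
  have -> : conjc sg ^+ 2 * ((kenergy b)%:C * sg ^+ 2) =
    (kenergy b)%:C * (conjc sg * sg) ^+ 2 by ring.
  by rewrite mul_conjc_unit // expr1n mulr1.
by rewrite Re_real; lra.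
Qed.

End Transform.

(** * Analytic continuation from a boundary solution *)

Section Tail.
Context {R : realType} (P : probability R R).
Hypothesis P0 : on_nneg P.
Variable b : R[i].
Hypothesis b0 : 0 < complex.Im b.
Local Notation y := (complex.Im b).

(** The second-order Taylor remainder; the plus sign is there because the derivative is
    [- kmoment P b 1]. In the coefficients below, [(-1) ^+ k] stands for [(-1) ^+ k.+2]. *)
Definition ktail (w : R[i]) : R[i] := ktrans P (b + w) - ktrans P b + w * kmoment P b 1.
Definition ktail_coef (k : nat) : R[i] := (-1) ^+ k * kmoment P b k.+2.

Lemma Im_shift_ge (w : R[i]) : normc w <= y / 2 -> y / 2 <= complex.Im (b + w).
Proof.
move=> hw; rewrite ImD; have := le_normc_Im w; rewrite ler_norml => /andP[h _].
by move: h hw; lra.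
Qed.

Lemma Im_shift_gt0 (w : R[i]) : normc w <= y / 2 -> 0 < complex.Im (b + w).
Proof. by move=> /Im_shift_ge; apply: lt_le_trans; rewrite divr_gt0. Qed.

Lemma normc_ktail_coef k : normc (ktail_coef k) <= y^-1 ^+ 3 * y^-1 ^+ k.
Proof.
rewrite /ktail_coef normcM normcX normc_opp normc1 expr1n mul1r -exprD.
exact: normc_kmoment_le.
Qed.

(** The expansion is taken with [n.+2] terms, two of which [ktail] removes; [normc w <= y / 2] gives
    the ratio one half, and [Im (b + w) >= y / 2] the factor [2 / y]. *)
Lemma ktail_series (w : R[i]) n : normc w <= y / 2 ->
  normc (\sum_(k < n) ktail_coef k * w ^+ k.+2 - ktail w) <= 2 / y * 2^-1 ^+ n.
Proof.
move=> hw; have bw0 := Im_shift_gt0 hw.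
have k0 : kmoment P b 0 = ktrans P b by apply: eq_cintegral => t; rewrite expr1.
have -> : \sum_(k < n) ktail_coef k * w ^+ k.+2 - ktail w =
  - (ktrans P (b + w) - \sum_(k < n.+2) (- w) ^+ k * kmoment P b k).
  rewrite 2!big_ord_recl k0 /ktail /= /bump /= expr0 expr1 mul1r.
  have -> : \sum_(i < n) (- w) ^+ (1 + (1 + i)) * kmoment P b (1 + (1 + i)) =
      \sum_(k < n) ktail_coef k * w ^+ k.+2.
    apply: eq_bigr => k _; rewrite /ktail_coef !add1n -[- w]mulN1r exprMn.
    by rewrite !exprS; ring.
  ring.
rewrite normc_opp; apply: le_trans (ktrans_expansion P0 _ b0 bw0) _.
rewrite -[n.+2]addn2 exprD -mulrA mulrC ler_pM ?exprn_ge0 ?divr_ge0 ?exprn_ge0 ?normc_ge0 ?(ltW b0) ?(ltW bw0) //.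
- rewrite divr_ge0 ?exprn_ge0 ?divr_ge0 ?normc_ge0 //; exact: ltW.
- rewrite -[leRHS]mul1r ler_pM ?exprn_ge0 ?divr_ge0 ?invr_ge0 ?normc_ge0 ?(ltW b0) ?(ltW bw0) //.
    rewrite expr_le1 ?divr_ge0 ?normc_ge0 ?(ltW b0) //.
    rewrite ler_pdivrMr // mul1r; apply: le_trans hw _.
    by move: b0; lra.
  rewrite -[2 / y]invf_div lef_pV2 ?posrE ?divr_gt0 //; exact: Im_shift_ge.
- rewrite lerXn2r ?nnegrE ?invr_ge0 ?divr_ge0 ?normc_ge0 ?(ltW b0) //.
  by rewrite ler_pdivrMr // mulrC.
Qed.

Lemma ktail_lipschitz (w w' : R[i]) : normc w <= y / 2 -> normc w' <= y / 2 ->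
  normc (ktail w - ktail w') <= 5 / y ^+ 2 * normc (w - w').
Proof.
move=> hw hw'; have bw := Im_shift_gt0 hw; have bw' := Im_shift_gt0 hw'.
have -> : ktail w - ktail w' = (ktrans P (b + w) - ktrans P (b + w')) +
  (w - w') * kmoment P b 1 by rewrite /ktail; ring.
apply: le_trans (normcD _ _) _.
(* [4 / y ^+ 2] is a Lipschitz constant of [ktrans] where imaginary parts are at least [y / 2]; the
   remaining [y^-1 ^+ 2] bounds [kmoment P b 1]. *)
have -> : 5 / y ^+ 2 * normc (w - w') = normc (w - w') * (4 / y ^+ 2) +
   normc (w - w') * (y^-1 ^+ 2) by rewrite exprVn; ring.
rewrite lerD //; last by rewrite normcM ler_wpM2l ?normc_ge0 // normc_kmoment_le.
apply: le_trans (ktrans_lipschitz P0 bw' bw) _.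
rewrite opprD addrACA subrr add0r ler_wpM2l ?normc_ge0 //.
have -> : 4 / y ^+ 2 = ((y / 2) * (y / 2))^-1 by field; rewrite gt_eqF.
rewrite lef_pV2 ?posrE ?mulr_gt0 ?divr_gt0 //.
by rewrite ler_pM ?divr_ge0 ?(ltW b0) // Im_shift_ge.
Qed.

End Tail.

(** * Jacobian and local continuation at a real point *)

Section BoundaryPoint.
Context {R : realType} (nu nut : probability R R) (c x : R) (D E : R[i]).
Hypotheses (nu0 : on_nneg nu) (nut0 : on_nneg nut) (c0 : 0 < c) (x0 : x != 0).
Hypotheses (D0 : 0 < complex.Im D) (E0 : 0 < complex.Im E).
Hypothesis eqD : x%:C * D = - ktrans nut E.
Hypothesis eqE : x%:C * E = - (c%:C * ktrans nu D).
Hypothesis DE : complex.Im (D * E) != 0.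

(** As [x] is real, the imaginary parts of the equations read x Im D = Im E * G_nut(E) and x Im E =
    c Im D * G_nu(D); multiply and cancel Im D * Im E. *)
Lemma energy_product : x ^+ 2 = c * kenergy nu D * kenergy nut E.
Proof.
have h1 : x * complex.Im D = complex.Im E * kenergy nut E.
  have := congr1 (@complex.Im R) eqD.
  by rewrite ImM Re_real Im_real mul0r addr0 ImN Im_ktrans // mulNr opprK.
have h2 : x * complex.Im E = c * complex.Im D * kenergy nu D.
  have := congr1 (@complex.Im R) eqE.
  by rewrite ImM ImN ImM !Re_real !Im_real !mul0r !addr0 Im_ktrans // !mulNr mulrN opprK mulrA.
have nz : complex.Im D * complex.Im E != 0 by rewrite mulf_neq0 ?gt_eqF.
apply: (mulIf nz).
have -> : x ^+ 2 * (complex.Im D * complex.Im E) = (x * complex.Im D) * (x * complex.Im E) by ring.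
by rewrite h1 h2; ring.
Qed.

(* Were the determinant to vanish, the phases of both kernels would be constant
   and mutually conjugate, making [D * E] real. *)
Lemma jacobian_neq0 :
  (x ^+ 2)%:C - c%:C * kmoment nu D 1 * kmoment nut E 1 != 0.
Proof.
apply/eqP => /eqP; rewrite subr_eq0 => /eqP hx.
have ep := energy_product.
have g0 := kenergy_ge0 nu D; have gt0 := kenergy_ge0 nut E.
have xp : 0 < x ^+ 2 by rewrite lt_neqAle sqr_ge0 andbT eq_sym sqrf_eq0.
have gp : 0 < kenergy nu D.
  rewrite lt_neqAle g0 andbT; apply: contraTneq xp => h.
  by rewrite ep -h mulr0 mul0r ltxx.
have gtp : 0 < kenergy nut E.
  rewrite lt_neqAle gt0 andbT; apply: contraTneq xp => h.
  by rewrite ep -h mulr0 ltxx.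
have n1 := normc_kmoment1_le nu0 D0; have n2 := normc_kmoment1_le nut0 E0.
have nx : x ^+ 2 = c * normc (kmoment nu D 1) * normc (kmoment nut E 1).
  have := congr1 (@normc R) hx; rewrite !normcM !normcr !ger0_norm //; exact: ltW.
have e1 : normc (kmoment nu D 1) = kenergy nu D.
  apply/eqP; rewrite eq_le n1 /= leNgt; apply/negP => h.
  have : c * normc (kmoment nu D 1) * normc (kmoment nut E 1) <
         c * kenergy nu D * kenergy nut E.
    apply: le_lt_trans (_ : c * normc (kmoment nu D 1) * kenergy nut E < _).
      by rewrite ler_wpM2l // mulr_ge0 ?normc_ge0 // ltW.
    by rewrite ltr_pM2r // ltr_pM2l.
  by rewrite -ep -nx ltxx.
pose g : R[i] := (kenergy nu D)%:C.
have gnz : g != 0 by rewrite -normc_eq0 normcr gtr0_norm ?gt_eqF.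
(* A square root of the phase of [kmoment nu D 1], hence up to sign the phase of the kernel of [nu];
   the vanishing determinant gives [kmoment nut E 1] the conjugate phase. *)
pose sg := sqrtc (kmoment nu D 1 / g).
have sg2 : sg ^+ 2 = kmoment nu D 1 / g by rewrite sqr_sqrtc.
have sg1 : normc sg = 1.
  have : normc sg ^+ 2 == 1.
    rewrite -normcX sg2 normcM normcV e1 /g normcr.
    by rewrite gtr0_norm // divff // gt_eqF.
  rewrite sqrf_eq1 => /orP[/eqP//|/eqP h].
  by have := normc_ge0 sg; rewrite h lerNr oppr0 leNgt ltr01.
have ph1 : complex.Im (conjc sg * ktrans nu D) = 0.
  by apply: ktrans_phase => //; rewrite sg2 mulrC divfK.
have sgJ := mul_conjc_unit sg1.
have knz : kmoment nu D 1 != 0 by rewrite -normc_eq0 e1 gt_eqF.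
have cnz : c%:C != 0 :> R[i] by rewrite -normc_eq0 normcr gtr0_norm ?gt_eqF.
have ph2 : complex.Im (conjc (conjc sg) * ktrans nut E) = 0.
  apply: ktrans_phase => //; first by rewrite normc_conjc.
  have k1 : kmoment nu D 1 = g * sg ^+ 2 by rewrite sg2 mulrC divfK.
  have s2 : conjc sg ^+ 2 * sg ^+ 2 = 1 by rewrite -exprMn sgJ expr1n.
  have : c%:C * kmoment nu D 1 * kmoment nut E 1 =
         c%:C * kmoment nu D 1 * ((kenergy nut E)%:C * conjc sg ^+ 2).
    rewrite -hx ep !rmorphM /= -/g k1.
    have -> : c%:C * (g * sg ^+ 2) * ((kenergy nut E)%:C * conjc sg ^+ 2) =
      c%:C * g * (kenergy nut E)%:C * (conjc sg ^+ 2 * sg ^+ 2) by ring.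
    by rewrite s2 mulr1.
  by move/(mulfI (mulf_neq0 cnz knz)).
(* The equations at [x] transfer the phases of the transforms to [D] and [E], and in [D * E] they
   cancel. *)
have imD : complex.Im (sg * D) = 0.
  rewrite conjcK in ph2.
  have h : x%:C * (sg * D) = - (sg * ktrans nut E).
    have -> : x%:C * (sg * D) = sg * (x%:C * D) by ring.
    by rewrite eqD mulrN.
  have := congr1 (@complex.Im R) h.
  rewrite ImM Re_real Im_real mul0r addr0 ImN ph2 oppr0 => /eqP.
  by rewrite mulf_eq0 (negbTE x0) => /eqP.
have imE : complex.Im (conjc sg * E) = 0.
  have h : x%:C * (conjc sg * E) = - (c%:C * (conjc sg * ktrans nu D)).
    have -> : x%:C * (conjc sg * E) = conjc sg * (x%:C * E) by ring.
    by rewrite eqE; ring.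
  have := congr1 (@complex.Im R) h.
  rewrite ImM Re_real Im_real mul0r addr0 ImN [complex.Im (c%:C * _)]ImM Re_real Im_real ph1 mulr0 mul0r addr0 oppr0.
  by move/eqP; rewrite mulf_eq0 (negbTE x0) => /eqP.
move: DE; have -> : D * E = (sg * D) * (conjc sg * E).
  have -> : (sg * D) * (conjc sg * E) = (conjc sg * sg) * (D * E) by ring.
  by rewrite sgJ mul1r.
by rewrite ImM imD imE mulr0 mul0r addr0 eqxx.
Qed.

Theorem local_analytic_solution : exists2 r : R, 0 < r &
  exists (b a : R[i] -> R[i]) (w : nat -> R[i]),
  (forall z, normc z < r ->
    [/\ 0 < complex.Im (b z), 0 < complex.Im (a z),
        (x%:C + z) * b z = - ktrans nut (a z),
        (x%:C + z) * a z = - (c%:C * ktrans nu (b z)) &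
        ccvg (fun n => \sum_(k < n) w k * z ^+ k) (b z * a z)]) /\
  (forall (s : R) (zs : nat -> R[i]) z, s < r -> (forall n, normc (zs n) <= s) ->
     normc z <= s -> ccvg zs z ->
     ccvg (fun n => b (zs n) * a (zs n)) (b z * a z)).
Proof.
pose h := kmoment nu D 1; pose ht := kmoment nut E 1.
pose det := (x ^+ 2)%:C - c%:C * h * ht.
have detnz : det != 0 := jacobian_neq0.
pose yD := complex.Im D; pose yE := complex.Im E.
have rho0 : 0 < Num.min (yD / 2) (yE / 2) by rewrite lt_min !divr_gt0.
(* Sums instead of maxima, so that each constant dominates those of both tails. *)
pose M := yE^-1 ^+ 3 + c * yD^-1 ^+ 3.
pose K := yE^-1 + yD^-1.
pose B := 2 / yE + c * (2 / yD).
pose L := 5 / yE ^+ 2 + c * (5 / yD ^+ 2).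
have yDi : 0 < yD^-1 by rewrite invr_gt0.
have yEi : 0 < yE^-1 by rewrite invr_gt0.
have yD3 : 0 < yD^-1 ^+ 3 by rewrite exprn_gt0.
have yE3 : 0 < yE^-1 ^+ 3 by rewrite exprn_gt0.
have c0' := ltW c0.
have M0 : 0 < M by rewrite addr_gt0 // mulr_gt0.
have K0 : 0 < K by rewrite addr_gt0.
pose al k := - ktail_coef nut E k; pose be k := - (c%:C * ktail_coef nu D k).
pose Fa w := - ktail nut E w; pose Fb w := - (c%:C * ktail nu D w).
have rhoD w : normc w <= Num.min (yD / 2) (yE / 2) -> normc w <= yD / 2.
  by rewrite le_min => /andP[].
have rhoE w : normc w <= Num.min (yD / 2) (yE / 2) -> normc w <= yE / 2.
  by rewrite le_min => /andP[].
have al_le k : normc (al k) <= M * K ^+ k.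
  rewrite normc_opp; apply: le_trans (normc_ktail_coef nut0 E0 _) _.
  rewrite ler_pM ?exprn_ge0 ?(ltW yEi) //; first by rewrite lerDl mulr_ge0 // ltW.
  by rewrite lerXn2r ?nnegrE ?(ltW yEi) ?(ltW K0) // lerDl ltW.
have be_le k : normc (be k) <= M * K ^+ k.
  rewrite normc_opp normcM normcr ger0_norm //.
  apply: le_trans (ler_wpM2l c0' (normc_ktail_coef nu0 D0 _)) _.
  rewrite mulrA ler_pM ?mulr_ge0 ?exprn_ge0 ?(ltW yDi) //; first by rewrite lerDr ltW.
  by rewrite lerXn2r ?nnegrE ?(ltW yDi) ?(ltW K0) // lerDr ltW.
have Fa_series w n : normc w <= Num.min (yD / 2) (yE / 2) ->
    normc (\sum_(k < n) al k * w ^+ k.+2 - Fa w) <= B * 2^-1 ^+ n.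
  move=> /rhoE hw.
  have -> : \sum_(k < n) al k * w ^+ k.+2 - Fa w =
     - (\sum_(k < n) ktail_coef nut E k * w ^+ k.+2 - ktail nut E w).
    by rewrite opprB addrC /Fa opprK -sumrN; congr (_ + _); apply: eq_bigr => k _; rewrite mulNr.
  rewrite normc_opp; apply: le_trans (ktail_series nut0 E0 _ hw) _.
  by rewrite ler_wpM2r ?exprn_ge0 ?invr_ge0 // lerDl !mulr_ge0 // ltW.
have Fb_series w n : normc w <= Num.min (yD / 2) (yE / 2) ->
    normc (\sum_(k < n) be k * w ^+ k.+2 - Fb w) <= B * 2^-1 ^+ n.
  move=> /rhoD hw.
  have -> : \sum_(k < n) be k * w ^+ k.+2 - Fb w =
     - (c%:C * (\sum_(k < n) ktail_coef nu D k * w ^+ k.+2 - ktail nu D w)).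
    rewrite mulrBr opprB addrC /Fb opprK mulr_sumr -sumrN; congr (_ + _).
    by apply: eq_bigr => k _; rewrite /be; ring.
  rewrite normc_opp normcM normcr ger0_norm //.
  apply: le_trans (ler_wpM2l c0' (ktail_series nu0 D0 _ hw)) _.
  by rewrite mulrA ler_wpM2r ?exprn_ge0 ?invr_ge0 // lerDr mulr_ge0 // ltW.
have Fa_lip w w' : normc w <= Num.min (yD / 2) (yE / 2) ->
    normc w' <= Num.min (yD / 2) (yE / 2) ->
    normc (Fa w - Fa w') <= L * normc (w - w').
  move=> /rhoE hw /rhoE hw'.
  rewrite -opprD normc_opp; apply: le_trans (ktail_lipschitz nut0 E0 hw hw') _.
  by rewrite ler_wpM2r ?normc_ge0 // lerDl mulr_ge0 // divr_ge0 // sqr_ge0.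
have Fb_lip w w' : normc w <= Num.min (yD / 2) (yE / 2) ->
    normc w' <= Num.min (yD / 2) (yE / 2) ->
    normc (Fb w - Fb w') <= L * normc (w - w').
  move=> /rhoD hw /rhoD hw'.
  rewrite -opprD normc_opp -mulrBr normcM normcr ger0_norm //.
  apply: le_trans (ler_wpM2l c0' (ktail_lipschitz nu0 D0 hw hw')) _.
  by rewrite mulrA ler_wpM2r ?normc_ge0 // lerDr divr_ge0 // sqr_ge0.
(* The four quotients form the inverse of the matrix with rows [(x, - ht)] and [(- c h, x)], the
   linear part in the increments [U] of [D] and [V] of [E]. *)
have [r rp [U [V [w [hUV hcont]]]]] := analytic_system_solution D E
  (x%:C / det) (ht / det) (c%:C * h / det) (x%:C / det)
  M0 K0 rho0 al_le be_le Fa_series Fb_series Fa_lip Fb_lip.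
exists r => //; exists (fun z => D + U z), (fun z => E + V z), w; split; last first.
  exact: hcont.
move=> z zr; have [/rhoD hU /rhoE hV eU eV cw] := hUV z zr; split => //.
- exact: Im_shift_gt0.
- exact: Im_shift_gt0.
- set X := Fa (V z) - z * (D + U z) in eU eV.
  set Y := Fb (U z) - z * (E + V z) in eU eV.
  have : x%:C * U z - ht * V z = X.
    rewrite eU eV; apply: (mulIf detnz); rewrite /det.
    by rewrite rmorphXn /=; field; move: detnz; rewrite /det rmorphXn.
  rewrite /X /Fa /ktail -/ht => h1.
  have -> : (x%:C + z) * (D + U z) = x%:C * D + (x%:C * U z - ht * V z)
    + ht * V z + z * (D + U z) by ring.
  by rewrite h1 eqD; ring.
- set X := Fa (V z) - z * (D + U z) in eU eV.
  set Y := Fb (U z) - z * (E + V z) in eU eV.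
  have : x%:C * V z - c%:C * h * U z = Y.
    rewrite eU eV; apply: (mulIf detnz); rewrite /det.
    by rewrite rmorphXn /=; field; move: detnz; rewrite /det rmorphXn.
  rewrite /Y /Fb /ktail -/h => h1.
  have -> : (x%:C + z) * (E + V z) = x%:C * E + (x%:C * V z - c%:C * h * U z)
    + c%:C * h * U z + z * (E + V z) by ring.
  by rewrite h1 eqE; ring.
Qed.

End BoundaryPoint.

(** * Existence of a boundary solution *)

Section Subsequences.
Context {R : realType}.

Lemma increasing_seq_cvg (f : nat -> nat) : increasing_seq f -> f @ \oo --> \oo.
Proof.
move=> fi A [N _ hN]; exists N => // n /= Nn; apply: hN => /=.
apply: leq_trans Nn _; elim: n => // n IH.
by apply: leq_ltn_trans IH _; move/increasing_seqP: fi; apply.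
Qed.

Lemma ccvg_subseq (u : nat -> R[i]) l f :
  increasing_seq f -> ccvg u l -> ccvg (u \o f) l.
Proof. by move=> /increasing_seq_cvg cf cu; apply: cvg_comp cf cu. Qed.

Lemma bounded_ccvg_subseq (u : nat -> R[i]) (M : R) : (forall n, normc (u n) <= M) ->
  exists2 f, increasing_seq f & exists l, ccvg (u \o f) l.
Proof.
move=> hM.
have bnd (v : nat -> R) : (forall n, `|v n| <= M) -> bounded_fun v.
  move=> hv; exists M; split; first exact: num_real.
  by move=> x Mx n _ /=; apply: le_trans (hv n) (ltW Mx).
have [f fi /cvg_ex[lr hr]] := bolzano_weierstrass
  (bnd (fun n => complex.Re (u n)) (fun n => le_trans (le_normc_Re _) (hM n))).
have [g gi /cvg_ex[li hi]] := bolzano_weierstrass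
  (bnd (fun n => complex.Im (u (f n))) (fun n => le_trans (le_normc_Im _) (hM (f n)))).
exists (f \o g).
  by move=> m n; rewrite /= (fi (g m) (g n)); exact: gi.
exists (lr +i* li); apply: ccvg_ReIm => //=.
exact: cvg_comp (increasing_seq_cvg gi) hr.
Qed.

End Subsequences.

(** * A priori bounds and compactness at the boundary *)

Section Boundary.
Context {R : realType} (nu nut : probability R R) (c : R).
Hypotheses (nu0 : on_nneg nu) (nut0 : on_nneg nut) (c0 : 0 < c).
Hypothesis nu_ndeg : ~ (forall A, measurable A -> nu A = \d_(0 : R) A).
Hypothesis nut_ndeg : ~ (forall A, measurable A -> nut A = \d_(0 : R) A).

(** Cleared of the division by [z] and free of any condition on [z], so that it makes sense at real
    points too. *)
Definition solution (z a b : R[i]) :=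
  [/\ 0 < complex.Im a, 0 < complex.Im b, z * b = - ktrans nut a &
      z * a = - (c%:C * ktrans nu b)].

Lemma solution_Im_mulb z a b : solution z a b ->
  complex.Im (z * b) = complex.Im a * kenergy nut a.
Proof. by case=> a0 b0 -> _; rewrite ImN Im_ktrans // mulNr opprK. Qed.

Lemma solution_Im_mula z a b : solution z a b ->
  complex.Im (z * a) = c * complex.Im b * kenergy nu b.
Proof.
case=> a0 b0 _ ->; rewrite ImN ImM Re_real Im_real mul0r addr0 Im_ktrans //.
by ring.
Qed.

Lemma solution_energy_le z a b : 0 < complex.Im z -> solution z a b ->
  c * kenergy nu b * kenergy nut a <= normc z ^+ 2.
Proof.
move=> z0 sol; have [a0 b0 _ eqa] := sol.
have znz : z != 0 by apply: contraTneq z0 => ->; rewrite ltxx.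
have zp : 0 < normc z ^+ 2 by rewrite exprn_gt0 // normc_gt0.
have := Im_ktrans_div_ge nu0 b0 z0; rewrite (solution_Im_mulb sol) => h.
have aE : a = c%:C * (- z^-1 * ktrans nu b).
  by apply: (mulfI znz); rewrite eqa; field.
have := congr1 (@complex.Im R) aE; rewrite [X in _ = X]ImM Re_real Im_real mul0r addr0 => ia.
have {}h : c * (complex.Im a * kenergy nut a / normc z ^+ 2 * kenergy nu b) <= complex.Im a.
  by rewrite [leRHS]ia ler_pM2l.
rewrite -(ler_pM2l a0) -ler_pdivrMr //; apply: le_trans h.
by rewrite le_eqVlt; apply/orP; left; apply/eqP; ring.
Qed.

(** As [normc a * normc b] is bounded, it is enough to keep both unknowns away from [0], which
    [small_ktrans] does while [z * a * b] is bounded below. *)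
Lemma solution_bounded (zl Z T s : R) : 0 < zl -> 0 < Z -> 0 < T -> 0 < s ->
  exists M : R, forall z a b, 0 < complex.Im z -> solution z a b ->
    zl <= normc z <= Z -> normc (z * a * b) <= T -> s <= normc (z * a * b) ->
    normc a <= M /\ normc b <= M.
Proof.
move=> zl0 Z0 T0 s0.
have [k kp hk] := kenergy_lower_bound nu0 nu_ndeg.
have [kt ktp hkt] := kenergy_lower_bound nut0 nut_ndeg.
pose C1 := Z ^+ 2 / (c * kt) * (1 + T / zl) ^+ 2.
pose C2 := Z ^+ 2 / (c * k) * (1 + T / zl) ^+ 2.
have T1 : 0 < 1 + T / zl by rewrite addr_gt0 // divr_gt0.
have C10 : 0 < C1 by rewrite mulr_gt0 ?divr_gt0 ?exprn_gt0 // mulr_gt0.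
have C20 : 0 < C2 by rewrite mulr_gt0 ?divr_gt0 ?exprn_gt0 // mulr_gt0.
have [b1 b1p hb1] := small_ktrans nu0 C10 (divr_gt0 s0 c0).
have [b2 b2p hb2] := small_ktrans nut0 C20 s0.
(* The [1] covers unknowns of modulus above [1], for which the energy hypothesis of [small_ktrans]
   is not checked. *)
pose m := Num.min 1 (Num.min b1 b2).
have mp : 0 < m by rewrite !lt_min ltr01 b1p.
exists (T / zl / m) => z a b z0 sol /andP[zlz zZ] hT hs.
have [a0 b0 eqb eqa] := sol.
have en := solution_energy_le z0 sol.
have en' : c * kenergy nu b * kenergy nut a <= Z ^+ 2.
  by apply: le_trans en _; rewrite lerXn2r ?nnegrE ?normc_ge0 // ltW.
have na := normc_ge0 a; have nb := normc_ge0 b.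
have ga := kenergy_ge0 nut a; have gb := kenergy_ge0 nu b.
have hab : normc a * normc b <= T / zl.
  rewrite ler_pdivlMr //; apply: le_trans hT; rewrite !normcM mulrC mulrA.
  by rewrite !ler_wpM2r.
(* For [u <= 1], [u * (1 + v) <= 1 + T / zl]; the product bound and the lower bound on the energy
   [gt] then control [u ^+ 2 * g], as [small_ktrans] requires. *)
have gen (u v g gt q : R) : 0 <= u -> u <= 1 -> 0 <= v -> 0 <= g -> 0 <= gt -> 0 < q ->
    v * u <= T / zl -> c * g * gt <= Z ^+ 2 -> q / (1 + v) ^+ 2 <= gt ->
    u ^+ 2 * g <= Z ^+ 2 / (c * q) * (1 + T / zl) ^+ 2.
  move=> u0 u1 v0 g0 gt0 q0 uv hZ hq.
  have v1 : 0 < 1 + v by rewrite ltr_pwDl.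
  have h1 : c * g * (q / (1 + v) ^+ 2) <= Z ^+ 2.
    by apply: le_trans hZ; rewrite ler_wpM2l // mulr_ge0 // ltW.
  have {}h1 : g <= Z ^+ 2 / (c * q) * (1 + v) ^+ 2.
    rewrite mulrAC ler_pdivlMr ?mulr_gt0 // -ler_pdivrMr ?exprn_gt0 //.
    apply: le_trans h1; rewrite le_eqVlt; apply/orP; left; apply/eqP; ring.
  apply: le_trans (ler_wpM2l (sqr_ge0 u) h1) _.
  rewrite mulrCA ler_wpM2l ?divr_ge0 ?sqr_ge0 //; first by rewrite mulr_ge0 // ltW.
  rewrite -exprMn lerXn2r ?nnegrE ?mulr_ge0 ?(ltW v1) ?(ltW T1) //.
  by rewrite mulrDr mulr1 lerD // mulrC.
have mb : m <= normc b.
  have [b_le1|/ltW b_gt1] := leP (normc b) 1; last first.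
    by apply: le_trans b_gt1; rewrite ge_min lexx.
  apply: (@le_trans _ _ b1); first by rewrite !ge_min lexx !orbT.
  apply: hb1 => //; first by apply: (gen _ (normc a) _ (kenergy nut a)) => //; exact: hkt.
  rewrite ler_pdivrMr //; apply: le_trans hs _.
  have -> : z * a * b = - (c%:C * (b * ktrans nu b)) by rewrite eqa; ring.
  by rewrite normc_opp normcM normcr gtr0_norm // mulrC.
have ma : m <= normc a.
  have [a_le1|/ltW a_gt1] := leP (normc a) 1; last first.
    by apply: le_trans a_gt1; rewrite ge_min lexx.
  apply: (@le_trans _ _ b2); first by rewrite !ge_min lexx !orbT.
  apply: hb2 => //.
    apply: (gen _ (normc b) _ (kenergy nu b)) => //; [by rewrite mulrC| |exact: hk].
    by rewrite mulrAC.
  apply: le_trans hs _.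
  have -> : z * a * b = - (a * ktrans nut a).
    have -> : z * a * b = a * (z * b) by ring.
    by rewrite eqb mulrN.
  by rewrite normc_opp.
split.
  rewrite ler_pdivlMr //; apply: le_trans hab; exact: ler_wpM2l.
rewrite ler_pdivlMr //; apply: le_trans hab; rewrite mulrC; exact: ler_wpM2r.
Qed.

Lemma ktrans_ccvg (P : probability R R) (u : nat -> R[i]) l : on_nneg P ->
  (forall n, 0 < complex.Im (u n)) -> 0 < complex.Im l -> ccvg u l ->
  ccvg (fun n => ktrans P (u n)) (ktrans P l).
Proof.
move=> P0 u0 l0 cu.
apply: (@ccvg_le _ _ _ (fun n => normc (u n - l) * (complex.Im l * complex.Im (u n))^-1)).
  by move=> n; exact: ktrans_lipschitz.
have -> : (0 : R) = 0 * (complex.Im l * complex.Im l)^-1 by rewrite mul0r.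
apply: cvgM => //; apply: cvgV; first by rewrite mulf_neq0 ?gt_eqF.
by apply: cvgM; [exact: cvg_cst|exact: ccvg_Im].
Qed.

(** The limits lie a priori only in the closed half plane. Energies bounded below along the sequence
    give two linear inequalities between [Im D] and [Im E], which survive the limit and, [D * E]
    being nonreal, exclude the real axis. *)
Lemma boundary_solution (x : R) (l : R[i]) (z a b : nat -> R[i]) : x != 0 ->
  (forall n, 0 < complex.Im (z n)) -> (forall n, solution (z n) (a n) (b n)) ->
  ccvg z x%:C -> ccvg (fun n => z n * a n * b n) l -> complex.Im l != 0 ->
  exists D E, solution x%:C E D /\ complex.Im (D * E) != 0.
Proof.
move=> x0 z0 sol cz cl l0.
have nx : 0 < `|x| by rewrite normr_gt0.
have nl : 0 < normc l.
  by rewrite normc_gt0; apply: contraNneq l0 => ->.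
have [N hN] : exists N, forall n, (N <= n)%N ->
    [/\ `|x| / 2 <= normc (z n) <= 2 * `|x|, normc (z n * a n * b n) <= 2 * normc l &
        normc l / 2 <= normc (z n * a n * b n)].
  have nx2 : 0 < `|x| / 2 by rewrite divr_gt0.
  have nl2 : 0 < normc l / 2 by rewrite divr_gt0.
  have [N1 _ h1] := (cvgr0_norm_lt _ cz) _ nx2.
  have [N2 _ h2] := (cvgr0_norm_lt _ cl) _ nl2.
  exists (maxn N1 N2) => n; rewrite geq_max => /andP[n1 n2].
  have := h1 n n1; rewrite /= (ger0_norm (normc_ge0 _)) => hz.
  have := h2 n n2; rewrite /= (ger0_norm (normc_ge0 _)) => hl.
  have two (u v : R[i]) : normc (u - v) < normc v / 2 ->
      normc v / 2 <= normc u /\ normc u <= 2 * normc v.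
    move=> h; have := normcD (u - v) v; have := normcB u (u - v).
    have -> : u - (u - v) = v by ring.
    rewrite subrK; have := normc_ge0 v; lra.
  have := two _ _ hl; have := two (z n) x%:C; rewrite normcr => /(_ hz)[-> ->] [-> ->].
  by [].
have [M hM] := @solution_bounded (`|x| / 2) (2 * `|x|) (2 * normc l) (normc l / 2)
  (divr_gt0 nx (ltr0Sn _ 1)) (mulr_gt0 (ltr0Sn _ 1) nx) (mulr_gt0 (ltr0Sn _ 1) nl)
  (divr_gt0 nl (ltr0Sn _ 1)).
have shift (u : nat -> R[i]) k : ccvg u k -> ccvg (fun n => u (n + N)%N) k.
  by move=> cu; rewrite /ccvg (@cvg_shiftn N _ (fun n => normc (u n - k))).
have hab n : normc (a (n + N)%N) <= M /\ normc (b (n + N)%N) <= M.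
  by have [h1 h2 h3] := hN (n + N)%N (leq_addl _ _); exact: hM.
have [f fi [E cE]] := bounded_ccvg_subseq (fun n => (hab n).1).
have [g gi [D cD]] := bounded_ccvg_subseq (fun n => (hab (f n)).2).
have {fi gi cE cD shift} [h [[cz' cE cD cl'] hMab]] : exists h : nat -> nat,
    [/\ ccvg (z \o h) x%:C, ccvg (a \o h) E, ccvg (b \o h) D &
        ccvg (fun n => z (h n) * a (h n) * b (h n)) l] /\
    (forall n, normc (a (h n)) <= M /\ normc (b (h n)) <= M).
  exists (fun n => f (g n) + N)%N; split; last by move=> n; exact: hab.
  split.
  - by have := ccvg_subseq gi (ccvg_subseq fi (shift _ _ cz)).
  - by have := ccvg_subseq gi cE.
  - exact: cD.
  - by have := ccvg_subseq gi (ccvg_subseq fi (shift _ _ cl)).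
have xDE : x%:C * E * D = l.
  by apply: ccvg_unique cl'; apply: ccvgM => //; exact: ccvgM.
have DE : complex.Im (D * E) != 0.
  apply: contraNneq l0 => h0; rewrite -xDE -mulrA (mulrC E) ImM h0.
  by rewrite Im_real mulr0 mul0r addr0.
have M1 : 0 < 1 + M.
  by rewrite ltr_pwDl //; apply: le_trans (hMab 0%N).1; exact: normc_ge0.
have energy_ge (k : R) (P : probability R R) u : 0 < k -> 0 < complex.Im u ->
    (forall b, 0 < complex.Im b -> k / (1 + normc b) ^+ 2 <= kenergy P b) ->
    normc u <= M -> k / (1 + M) ^+ 2 <= kenergy P u.
  move=> k0 u0 hk hu; apply: le_trans (hk u u0).
  have u1 : 0 < 1 + normc u by rewrite ltr_pwDl // normc_ge0.
  rewrite ler_wpM2l ?(ltW k0) // lef_pV2 ?posrE ?exprn_gt0 //.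
  by rewrite lerXn2r ?nnegrE ?(ltW M1) ?(ltW u1) // lerD2l.
have [k kp hk] := kenergy_lower_bound nu0 nu_ndeg.
have [kt ktp hkt] := kenergy_lower_bound nut0 nut_ndeg.
pose q := k / (1 + M) ^+ 2; pose qt := kt / (1 + M) ^+ 2.
have qp : 0 < q by rewrite divr_gt0 // exprn_gt0.
have qtp : 0 < qt by rewrite divr_gt0 // exprn_gt0.
have D_ge0 : 0 <= complex.Im D.
  apply: (cvgr_to_ge (ccvg_Im cD)); apply: nearW => n /=.
  by have [_ /ltW] := sol (h n).
have E_ge0 : 0 <= complex.Im E.
  apply: (cvgr_to_ge (ccvg_Im cE)); apply: nearW => n /=.
  by have [/ltW] := sol (h n).
have xDE_le : qt * complex.Im E <= x * complex.Im D.
  have -> : x * complex.Im D = complex.Im (x%:C * D).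
    by rewrite ImM Re_real Im_real mul0r addr0.
  rewrite -subr_ge0.
  have cv : (fun n => complex.Im (z (h n) * b (h n)) - qt * complex.Im (a (h n)))
      @ \oo --> complex.Im (x%:C * D) - qt * complex.Im E.
    apply: cvgB; first exact: (ccvg_Im (ccvgM cz' cD)).
    by apply: cvgM; [exact: cvg_cst|exact: ccvg_Im].
  apply: (cvgr_to_ge cv); apply: nearW => n /=.
  have [a0 b0 _ _] := sol (h n).
  rewrite subr_ge0 (solution_Im_mulb (sol (h n))) mulrC ler_pM2l //.
  by apply: energy_ge => //; exact: (hMab n).1.
have xED_le : c * q * complex.Im D <= x * complex.Im E.
  have -> : x * complex.Im E = complex.Im (x%:C * E).
    by rewrite ImM Re_real Im_real mul0r addr0.
  rewrite -subr_ge0.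
  have cv : (fun n => complex.Im (z (h n) * a (h n)) - c * q * complex.Im (b (h n)))
      @ \oo --> complex.Im (x%:C * E) - c * q * complex.Im D.
    apply: cvgB; first exact: (ccvg_Im (ccvgM cz' cE)).
    by apply: cvgM; [exact: cvg_cst|exact: ccvg_Im].
  apply: (cvgr_to_ge cv); apply: nearW => n /=.
  have [a0 b0 _ _] := sol (h n).
  rewrite subr_ge0 (solution_Im_mula (sol (h n))) mulrAC ler_pM2l ?mulr_gt0 //.
  by apply: energy_ge => //; exact: (hMab n).2.
(* If [Im D] vanished, [xDE_le] would make [E] real too, and [D * E] with it. *)
have D0 : 0 < complex.Im D.
  rewrite lt_neqAle D_ge0 andbT eq_sym; apply: contraNneq DE => h0.
  have E_le0 : complex.Im E <= 0.
    by rewrite -(pmulr_rle0 _ qtp); move: xDE_le; rewrite h0 mulr0.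
  have -> : complex.Im (D * E) = 0; last by [].
  by rewrite ImM h0 (le_anti (introT andP (conj E_le0 E_ge0))) mulr0 mul0r addr0.
have E0 : 0 < complex.Im E.
  rewrite lt_neqAle E_ge0 andbT eq_sym; apply: contraTneq xED_le => h0.
  by rewrite h0 mulr0 -ltNge; apply: mulr_gt0 => //; exact: mulr_gt0.
exists D, E; split => //; split => //.
- apply: (ccvg_unique (ccvgM cz' cD)).
  rewrite (_ : (fun n => _) = fun n => -1 * ktrans nut (a (h n))).
    rewrite -[X in ccvg _ X]mulN1r; apply: ccvgM; first exact: ccvg_cst.
    by apply: ktrans_ccvg => // n; have [] := sol (h n).
  by apply/funext => n /=; have [_ _ -> _] := sol (h n); rewrite mulN1r.
- apply: (ccvg_unique (ccvgM cz' cE)).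
  rewrite (_ : (fun n => _) = fun n => - c%:C * ktrans nu (b (h n))).
    rewrite -mulNr; apply: ccvgM; first exact: ccvg_cst.
    by apply: ktrans_ccvg => // n; have [] := sol (h n).
  by apply/funext => n /=; have [_ _ _ ->] := sol (h n); rewrite mulNr.
Qed.


End Boundary.

(** * Analyticity of the density *)

Section UpperHalfPlane.
Context {R : realType}.

Lemma cvg_within_CplusP (m : R[i] -> R[i]) (x l : R[i]) :
  m @ within (@Cplus R) (nbhs x) --> l ->
  forall e : R, 0 < e -> exists2 d : R, 0 < d &
    forall z, 0 < complex.Im z -> normc (z - x) < d -> normc (m z - l) < e.
Proof.
move=> h e e0.
have e0' : 0 < e%:C :> R[i] by rewrite (ltcR 0 e).
have := h _ (nbhsx_ballx l (e%:C) e0').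
rewrite /= /nbhs /= => /nbhs_ballP[d /= d0 hd].
(* A positive element of [R[i]] is real, so the radius of the ball is. *)
have dE : d = (complex.Re d)%:C.
  by move: d0; rewrite ltcE /= => /andP[/eqP h0 _]; apply: complex_ext.
exists (complex.Re d); first by move: d0; rewrite ltcE /= => /andP[].
move=> z z0 hz; have := hd z; rewrite /ball /= => hb.
have : `|l - m z| < e%:C.
  apply: hb => //; rewrite /ball_ /= dE; change ((normc (x - z))%:C < (complex.Re d)%:C).
  by rewrite ltcR normcBC.
change ((normc (l - m z))%:C < e%:C -> normc (m z - l) < e).
by rewrite ltcR normcBC.
Qed.

Lemma cintegral_kernel (P : probability R R) (z b : R[i]) : 0 < complex.Im b ->
  cintegral P (fun t => t%:C / (- z * (1 + b * t%:C))) = - z^-1 * ktrans P b.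
Proof.
move=> b0; rewrite -cintegralZ; last exact: cbm_kernel.
by apply: eq_cintegral => t; rewrite invfM invrN mulrCA.
Qed.

Lemma cintegral_resolvent (P : probability R R) (z b : R[i]) : 0 < complex.Im b ->
  cintegral P (fun t => 1 / (- z * (1 + b * t%:C))) =
    - z^-1 * cintegral P (resolvent b).
Proof.
move=> b0; rewrite -cintegralZ; last exact: cbm_resolvent.
by apply: eq_cintegral => t; rewrite invfM invrN mul1r.
Qed.

Lemma ccvg_vertical (y h : R) : ccvg (fun n => y +i* (h / n.+1%:R)) y%:C.
Proof.
apply: ccvg_ReIm => /=; first exact: cvg_cst.
rewrite -[X in _ --> X](mulr0 h); apply: cvgM; first exact: cvg_cst.
exact: cvg_harmonic.
Qed.

End UpperHalfPlane.

(** * Boundary values of the Stieltjes transform *)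

Section DensityAnalytic.
Context {R : realType} (nu nut : probability R R) (c : R).
Context (delta deltat m : R[i] -> R[i]) (mlim : R -> R[i]).
Hypotheses (c0 : 0 < c) (nu0 : on_nneg nu) (nut0 : on_nneg nut).
Hypothesis nu_ndeg : ~ (forall A, measurable A -> nu A = \d_(0 : R) A).
Hypothesis nut_ndeg : ~ (forall A, measurable A -> nut A = \d_(0 : R) A).
Hypothesis sol : forall z, 0 < complex.Im z ->
  solution nu nut c z (delta z) (deltat z).
Hypothesis sol_unique : forall z a b, 0 < complex.Im z ->
  solution nu nut c z a b -> a = delta z /\ b = deltat z.
Hypothesis mE : forall z, 0 < complex.Im z ->
  m z = - z^-1 * cintegral nu (resolvent (deltat z)).
Hypothesis m_cvg : forall x : R, x != 0 ->
  m @ within (@Cplus R) (nbhs (x%:C)) --> mlim x.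

Lemma mul_m z : 0 < complex.Im z ->
  z * m z = - 1 - z * (deltat z * delta z) / c%:C.
Proof.
move=> z0; have znz : z != 0 by apply: contraTneq z0 => ->; rewrite ltxx.
have cnz : c%:C != 0 :> R[i] by rewrite -normc_eq0 normcr gtr0_norm ?gt_eqF.
have [a0 b0 _ eqa] := sol z0.
have -> : z * (deltat z * delta z) / c%:C = - (deltat z * ktrans nu (deltat z)).
  have -> : z * (deltat z * delta z) = deltat z * (z * delta z) by ring.
  by rewrite eqa; field.
by rewrite mul_ktrans // mE //; field.
Qed.

Lemma m_ccvg_vertical (y h : R) : y != 0 -> 0 < h ->
  ccvg (fun n => m (y +i* (h / n.+1%:R))) (mlim y).
Proof.
move=> y0 h0; apply/cvgr0Pnorm_lt => e e0.
have [d d0 hd] := cvg_within_CplusP (m_cvg y0) e0.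
have [N _ hN] := (cvgr0_norm_lt _ (ccvg_vertical y h)) _ d0.
exists N => // n /hN; rewrite /= !ger0_norm ?normc_ge0 // => hn.
by apply: hd => //=; rewrite divr_gt0.
Qed.

(** Analyticity is claimed at every point near [x], and each gets its own boundary solution, which
    requires positivity there. [Im m] exceeds half its limit on a half-disc around [x], and the
    boundary values inherit this lower bound. *)
Lemma Im_mlim_gt0_near (x : R) : x != 0 -> 0 < complex.Im (mlim x) ->
  exists2 e : R, 0 < e & forall y, `|y - x| < e -> y != 0 /\ 0 < complex.Im (mlim y).
Proof.
move=> x0 mx0; set I := complex.Im (mlim x) in mx0.
have I2 : 0 < I / 2 by rewrite divr_gt0.
have [d d0 hd] := cvg_within_CplusP (m_cvg x0) I2.
have nx : 0 < `|x| by rewrite normr_gt0.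
exists (Num.min d `|x|); first by rewrite lt_min d0.
move=> y; rewrite lt_min => /andP[yd yx].
have y0 : y != 0 by apply: contraTneq yx => ->; rewrite sub0r normrN ltxx.
split=> //.
(* This height keeps the vertical segment above [y] inside the half-disc of radius [d]. *)
pose h := (d - `|y - x|) / 2.
have h0 : 0 < h by rewrite divr_gt0 // subr_gt0.
apply: lt_le_trans I2 _.
apply: (cvgr_to_ge (ccvg_Im (m_ccvg_vertical y0 h0))); apply: nearW => n /=.
set z := y +i* _.
have z0 : 0 < complex.Im z by rewrite /= divr_gt0.
have hn : h / n.+1%:R <= h by rewrite ler_pdivrMr // ler_pMr // ler1n.
have hz : normc (z - x%:C) < d.
  apply: le_lt_trans (normc_le_ReIm _) _; rewrite /= subr0 (gtr0_norm z0) /=.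
  by move: (h / n.+1%:R) hn => q; move: yd; rewrite /h; lra.
have := hd z z0 hz; have := le_normc_Im (m z - mlim x).
rewrite ImD ImN -/I ler_norml => /andP[h1 _] h2; lra.
Qed.

Theorem density_analytic_at (x : R) : x != 0 -> 0 < complex.Im (mlim x) ->
  real_analytic_at (fun y => complex.Im (mlim y) / pi) x.
Proof.
move=> x0 mx0.
have cnz : c%:C != 0 :> R[i] by rewrite -normc_eq0 normcr gtr0_norm ?gt_eqF.
pose z n : R[i] := x +i* (1 / n.+1%:R).
have z0 n : 0 < complex.Im (z n) by rewrite /= divr_gt0.
have cz : ccvg z x%:C := ccvg_vertical x 1.
have cm : ccvg (fun n => m (z n)) (mlim x) := m_ccvg_vertical x0 ltr01.
(* By [mul_m] the limit of the product is read off from that of [m]; its imaginary part is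
   [- c * x * Im (mlim x)], which is nonzero. *)
pose l := - c%:C * (1 + x%:C * mlim x).
have cl : ccvg (fun n => z n * delta (z n) * deltat (z n)) l.
  rewrite (_ : (fun n => _) = fun n => - c%:C * (1 + z n * m (z n))).
    apply: ccvgM; first exact: ccvg_cst.
    by apply: ccvgD; [exact: ccvg_cst|exact: ccvgM].
  by apply/funext => n; rewrite mul_m //; field.
have l0 : complex.Im l != 0.
  have -> : complex.Im l = - (c * (x * complex.Im (mlim x))).
    by rewrite /l; case: (mlim x) => u v /=; ring.
  by rewrite oppr_eq0 !mulf_neq0 // gt_eqF.
have [D [E [[E0 D0 eqD eqE] DE]]] := boundary_solution nu0 nut0 c0 nu_ndeg nut_ndeg
  x0 z0 (fun n => sol (z0 n)) cz cl l0.
have [r r0 [b [a [w [hba hcont]]]]] :=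
  local_analytic_solution nu0 nut0 c0 x0 D0 E0 eqD eqE DE.
have nx : 0 < `|x| by rewrite normr_gt0.
have mlimE y : `|y - x| < Num.min r `|x| ->
    complex.Im (mlim y) = - complex.Im (b (y - x)%:C * a (y - x)%:C) / c.
  rewrite lt_min => /andP[yr yx].
  have y0 : y != 0 by apply: contraTneq yx => ->; rewrite sub0r normrN ltxx.
  (* Since [|y - x| + h = s < r], the vertical approach to [y] stays in a disc where the local
     product is continuous. *)
  pose h := (r - `|y - x|) / 2; pose s := (r + `|y - x|) / 2.
  have h0 : 0 < h by rewrite divr_gt0 // subr_gt0.
  have sr : s < r by rewrite /s; lra.
  have ys : `|y - x| <= s by rewrite /s; lra.
  pose zy n : R[i] := y +i* (h / n.+1%:R).
  pose ze n : R[i] := (y - x) +i* (h / n.+1%:R).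
  have zye n : zy n = x%:C + ze n by apply: complex_ext; rewrite /= ?add0r // addrC subrK.
  have zy0 n : 0 < complex.Im (zy n) by rewrite /= divr_gt0.
  have zes n : normc (ze n) <= s.
    apply: le_trans (normc_le_ReIm _) _; rewrite /= (gtr0_norm (zy0 n)) /=.
    have hn : h / n.+1%:R <= h by rewrite ler_pdivrMr // ler_pMr // ler1n.
    by move: (h / n.+1%:R) hn => q; rewrite /h /s; lra.
  have ns : normc (y - x)%:C <= s by rewrite normcr.
  have cba := hcont s ze _ sr zes ns (ccvg_vertical (y - x) h).
  have key : y%:C * mlim y = -1 - y%:C * (b (y - x)%:C * a (y - x)%:C) / c%:C.
    apply: (ccvg_unique (ccvgM (ccvg_vertical y h) (m_ccvg_vertical y0 h0))).
    rewrite (_ : (fun n => _) = fun n => -1 + - c%:C^-1 * (zy n * (b (ze n) * a (ze n)))).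
      have -> : -1 - y%:C * (b (y - x)%:C * a (y - x)%:C) / c%:C =
        -1 + - c%:C^-1 * (y%:C * (b (y - x)%:C * a (y - x)%:C)) by ring.
      apply: ccvgD; first exact: ccvg_cst.
      apply: ccvgM; first exact: ccvg_cst.
      by apply: ccvgM => //; exact: ccvg_vertical.
    apply/funext => n.
    have [b0 a0 e1 e2 _] := hba _ (le_lt_trans (zes n) sr).
    (* In the upper half plane uniqueness identifies the local solution with [delta] and
       [deltat]. *)
    have [|-> ->] := @sol_unique (zy n) (a (ze n)) (b (ze n)) (zy0 n).
      by split => //; rewrite zye.
    by rewrite -/(zy n) mul_m //; ring.
  have := congr1 (@complex.Im R) key.
  have -> : y%:C * (b (y - x)%:C * a (y - x)%:C) / c%:C =
    (y / c)%:C * (b (y - x)%:C * a (y - x)%:C) by rewrite rmorphM fmorphV /=; ring.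
  rewrite ImD !ImN !Im_realM (_ : complex.Im 1 = 0) // oppr0 add0r => hy.
  by apply: (mulfI y0); rewrite hy; ring.
exists (Num.min r `|x|); first by rewrite lt_min r0.
(* As [y - x] is real, taking imaginary parts acts on the coefficients only; the real term [- 1 / y]
   of [mlim y] has already dropped out. *)
exists (fun k => - complex.Im (w k) / (c * pi)) => y hy.
rewrite mlimE //.
have yr : normc (y - x)%:C < r by rewrite normcr; move: hy; rewrite lt_min => /andP[].
have [_ _ _ _ cw] := hba _ yr.
have -> : - complex.Im (b (y - x)%:C * a (y - x)%:C) / c / pi =
  - (c * pi)^-1 * complex.Im (b (y - x)%:C * a (y - x)%:C) by rewrite invfM; ring.
rewrite (_ : (fun n => _) = fun n => - (c * pi)^-1 *
   complex.Im (\sum_(k < n) w k * (y - x)%:C ^+ k)).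
  by apply: cvgM; [exact: cvg_cst|exact: ccvg_Im].
apply/funext => n; elim: n => [|n IH]; first by rewrite !big_ord0 mulr0.
rewrite !big_ord_recr /= IH ImD [RHS]mulrDr; congr (_ + _).
by rewrite -rmorphXn /= ImM Re_real Im_real mulr0 add0r; ring.
Qed.


End DensityAnalytic.

Unset Implicit Arguments.

Theorem theorem3p12 (R : realType) (c : R)
  (nu nut : probability R R)
  (delta deltat m : R[i] -> R[i]) (mlim : R -> R[i]) :
  0 < c ->
  (* nu, nut are probability measures on R_+ (no mass on (-oo,0)) *)
  nu [set t : R | t < 0] = 0%E ->
  nut [set t : R | t < 0] = 0%E ->
  (* nu, nut are different from the Dirac mass at 0 *)
  ~ (forall A, measurable A -> nu A = \d_(0 : R) A) ->
  ~ (forall A, measurable A -> nut A = \d_(0 : R) A) ->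
  (* (delta z, deltat z) is the unique solution in C_+^2 of the system *)
  (forall z : R[i], Cplus z ->
     [/\ Cplus (delta z), Cplus (deltat z),
         delta z = c%:C * cintegral nu
                     (fun t => t%:C / (- z * (1 + deltat z * t%:C))),
         deltat z = cintegral nut
                     (fun t => t%:C / (- z * (1 + delta z * t%:C))) &
         forall d dt : R[i], Cplus d -> Cplus dt ->
           d = c%:C * cintegral nu (fun t => t%:C / (- z * (1 + dt * t%:C))) ->
           dt = cintegral nut (fun t => t%:C / (- z * (1 + d * t%:C))) ->
           d = delta z /\ dt = deltat z]) ->
  (* definition of m on C_+ *)
  (forall z : R[i], Cplus z ->
     m z = cintegral nu (fun t => 1 / (- z * (1 + deltat z * t%:C)))) ->
  (* m(x) := lim_{z in C_+ -> x} m(z), for x <> 0 *)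
  (forall x : R, x != 0 ->
     m @ within (@Cplus R) (nbhs (x%:C)) --> mlim x) ->
  let f := fun x : R => complex.Im (mlim x) / pi in
  forall x : R, x != 0 -> 0 < f x ->
    exists2 e : R, 0 < e &
      forall y : R, `|y - x| < e -> real_analytic_at f y.
Proof.
move=> c0 nu0 nut0 nu_ndeg nut_ndeg hsol hm hlim f x x0 fx0.
have cnz : c%:C != 0 :> R[i] by rewrite -normc_eq0 normcr gtr0_norm ?gt_eqF.
have znz (z : R[i]) : 0 < complex.Im z -> z != 0.
  by apply: contraTneq => ->; rewrite ltxx.
have sol z : 0 < complex.Im z -> solution nu nut c z (delta z) (deltat z).
  move=> z0; have [a0 b0 ea eb _] := hsol z z0; split => //.
    by rewrite {1}eb cintegral_kernel // mulNr mulrN mulVKf ?znz.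
  by rewrite {1}ea cintegral_kernel //; field; exact: znz.
have sol_unique z a b : 0 < complex.Im z -> solution nu nut c z a b ->
    a = delta z /\ b = deltat z.
  move=> z0 [a0 b0 eb ea]; have [_ _ _ _ uniq] := hsol z z0.
  apply: uniq => //; rewrite cintegral_kernel //; apply: (mulfI (znz _ z0)).
    by rewrite ea; field; exact: znz.
  by rewrite eb; field; exact: znz.
have mE z : 0 < complex.Im z -> m z = - z^-1 * cintegral nu (resolvent (deltat z)).
  by move=> z0; have [_ b0 _ _ _] := hsol z z0; rewrite hm // cintegral_resolvent.
have pi0 : 0 < (pi : R) by exact: pi_gt0.
have mx0 : 0 < complex.Im (mlim x) by move: fx0; rewrite /f pmulr_lgt0 // invr_gt0.
have [e e0 he] := Im_mlim_gt0_near hlim x0 mx0.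
exists e => // y /he[y0 my0].
exact: (density_analytic_at c0 nu0 nut0 nu_ndeg nut_ndeg sol sol_unique mE hlim y0 my0).
Qed.
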